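(* Let $X$ be a separable reflexive Banach space, $(\Omega,\beta,\mu)$ a finite measure space, and $\{T_t,\,t\ge 0\}$ a strongly continuous semigroup of linear $L_1$-$L_\infty$ contractions on $L_1(\Omega,X)$ which is positively dominated by some strongly continuous semigroup $\{P_t,t\ge0\}$ of linear $L_1$-$L_\infty$ contractions on $L_1=L_1(\Omega,\mathbb{R})$. Let $1<p<\infty$, let $f\in L_p(\Omega,X)$ with $\sup_{t>0}\|A_tf\|_X\in L_1$, and let $F_s\downarrow F$ as $s\to\infty$ be a decreasing family of sub-$\sigma$-algebras of $\beta$. Then: (1) $$\Big\|\sup_{t,s}\|E(A_tf|F_s)\|_X\Big\|_p\le\Big(\frac{p}{p-1}\Big)^2\|f\|_p;$$ (2) for every $\varepsilon>0$, $$\mu\Big\{\sup_{t,s}\|E(A_tf|F_s)\|_X\ge\varepsilon\Big\}\le\frac{p}{p-1}\,\frac{\|f\|_p}{\varepsilon}.$$ Here the suprema are over $t>0$ and $s\ge0$.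
   Context: $L_p(\Omega,X)$, $1\le p<\infty$, is the Banach space of $X$-valued (strongly) measurable functions $f$ on $\Omega$ with $\|f\|_p=\left(\int_\Omega\|f(\omega)\|_X^p\,d\mu\right)^{1/p}<\infty$; one writes $L_p$ when $X=\mathbb{R}$; $\|f\|_\infty=\inf\{\lambda:\|f(\omega)\|_X\le\lambda\text{ a.e.}\}$. A linear operator $T$ on $L_1(\Omega,X)$ is an $L_1$-$L_\infty$ contraction if $\|Tf\|_1\le\|f\|_1$ and $\|Tf\|_\infty\le\|f\|_\infty$. A family $\{T_t,t\ge0\}$ of linear operators on $L_1(\Omega,X)$ is a strongly continuous semigroup if $T_0=\mathrm{id}$, $T_{t_1}T_{t_2}=T_{t_1+t_2}$ for all $t_1,t_2>0$, and $\lim_{t_1\to t_2}\|T_{t_1}f-T_{t_2}f\|_1=0$ for every $f\in L_1(\Omega,X)$ and $t_2>0$. The flow $\{T_t,t\ge0\}$ in $L_1(\Omega,X)$ is positively dominated by the flow $\{P_t,t\ge0\}$ in $L_1$ if for every $f\in L_1(\Omega,X)$ and $t\ge0$ one has $\|T_tf\|_X\le P_t(\|f\|_X)$ a.e., where $\|f\|_X$ denotes the function $\omega\mapsto\|f(\omega)\|_X$. The ergodic average is $A_tf(\omega)=\frac1t\int_0^tT_\tau f(\omega)\,d\tau$, $t>0$. $E(\cdot|F)$ is the (Bochner) conditional expectation operator with respect to the sub-$\sigma$-algebra $F$. $F_s\downarrow F$ means $F_{s_1}\supset F_{s_2}$ for $s_1<s_2$ and $F=\bigcap_sF_s$.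
   Formalization: Part (2) is proved under the extra assumption μ(Ω) ≤ 1; it fails for large finite mass (X = R, T_t = P_t = id, f = 1, trivial F_s, p = 2, ε = 1, μ(Ω) = 16 gives 16 ≤ 8). Part (1) holds for every finite measure. The supremum over t, s is the essential supremum. *)

(* Defs.v *)
From HB Require Import structures.
From mathcomp Require Import all_boot all_order all_algebra.
From mathcomp Require Import all_classical all_reals all_analysis measurable_realfun.

Set Implicit Arguments.
Unset Strict Implicit.
Unset Printing Implicit Defensive.

Import Order.TTheory GRing.Theory Num.Theory.
Import numFieldNormedType.Exports.

Local Open Scope classical_set_scope.
Local Open Scope ring_scope.

Definition separable_space (X : topologicalType) : Prop :=
  exists2 S : set X, countable S & dense S.

Definition dual (R : realType) (X : normedModType R) : set (X -> R) :=
  [set phi | (forall (a : R) (x y : X), phi (a *: x + y) = a * phi x + phi y)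
             /\ continuous phi].

Definition dual_norm (R : realType) (X : normedModType R) (phi : X -> R) : R :=
  sup [set `|phi x| | x in [set x : X | `|x| <= 1]].

(* The canonical embedding of X into its bidual is onto. Only the values of
   [Phi] on [dual X] matter. *)
Definition reflexive_space (R : realType) (X : normedModType R) : Prop :=
  forall Phi : (X -> R) -> R,
    (forall (a : R) (phi psi : X -> R), dual phi -> dual psi ->
       Phi (fun x => a * phi x + psi x) = a * Phi phi + Phi psi) ->
    (exists M : R, forall phi, dual phi -> `|Phi phi| <= M * dual_norm phi) ->
    exists x : X, forall phi, dual phi -> Phi phi = phi x.

(* The sigma-algebra is a parameter, so that the same notions serve for the
   sub-sigma-algebras of conditional expectations. *)
Definition simple_function (T : Type) (R : realType) (X : normedModType R)
    (G : set (set T)) (s : T -> X) : Prop :=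
  finite_set (range s) /\ forall x : X, G (s @^-1` [set x]).

Definition strongly_measurable (T : Type) (R : realType) (X : normedModType R)
    (G : set (set T)) (f : T -> X) : Prop :=
  exists s : nat -> T -> X, (forall n, simple_function G (s n)) /\
    (forall w : T, s n w @[n --> \oo] --> f w).

Definition Lpnorm d (T : measurableType d) (R : realType)
    (X : normedModType R) (mu : {measure set T -> \bar R}) (p : \bar R)
    (f : T -> X) : \bar R :=
  Lnorm mu p (fun w => `|f w|%:E).

(* Elements of L_p are represented by functions; equality in L_p is equality
   mu-almost everywhere. *)
Definition in_Lp d (T : measurableType d) (R : realType)
    (X : normedModType R) (mu : {measure set T -> \bar R}) (p : \bar R)
    (f : T -> X) : Prop :=
  strongly_measurable measurable f /\ (Lpnorm mu p f < +oo)%E.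

Definition simple_integral d (T : measurableType d) (R : realType)
    (X : normedModType R) (mu : {measure set T -> \bar R}) (D : set T)
    (s : T -> X) : X :=
  \sum_(x \in range s) fine (mu (D `&` s @^-1` [set x])) *: x.

Definition is_bochner_integral d (T : measurableType d) (R : realType)
    (X : normedModType R) (mu : {measure set T -> \bar R}) (D : set T)
    (f : T -> X) (v : X) : Prop :=
  strongly_measurable measurable f /\
  exists s : nat -> T -> X,
    [/\ forall n, simple_function measurable (s n),
        forall n, (\int[mu]_(w in D) `|s n w|%:E < +oo)%E,
        (\int[mu]_(w in D) `|f w - s n w|%:E)%E @[n --> \oo] --> 0%E &
        simple_integral mu D (s n) @[n --> \oo] --> v].

(* 0 when f is not Bochner integrable on D *)
Definition bochner d (T : measurableType d) (R : realType)
    (X : normedModType R) (mu : {measure set T -> \bar R}) (D : set T)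
    (f : T -> X) : X :=
  xget 0 [set v | is_bochner_integral mu D f v].

Definition sub_sigma_algebra d (T : measurableType d) (G : set (set T)) :
    Prop :=
  sigma_algebra setT G /\ G `<=` measurable.

(* g is a version of E(f | G), for f in L_1 *)
Definition is_condexp d (T : measurableType d) (R : realType)
    (X : normedModType R) (mu : {measure set T -> \bar R}) (G : set (set T))
    (f g : T -> X) : Prop :=
  [/\ strongly_measurable G g, in_Lp mu 1%E g &
      forall B, G B -> bochner mu B g = bochner mu B f].

Definition decreasing_family d (T : measurableType d) (R : realType)
    (F : R -> set (set T)) (Finf : set (set T)) : Prop :=
  [/\ forall s, 0 <= s -> sub_sigma_algebra (F s),
      forall s1 s2, 0 <= s1 -> s1 < s2 -> F s2 `<=` F s1 &
      Finf = \bigcap_(s in [set s | 0 <= s]) F s].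

(* A linear operator on L_1, acting on representatives. *)
Definition L1_operator d (T : measurableType d) (R : realType)
    (X : normedModType R) (mu : {measure set T -> \bar R})
    (U : (T -> X) -> (T -> X)) : Prop :=
  [/\ forall f, in_Lp mu 1%E f -> in_Lp mu 1%E (U f),
      forall f g, in_Lp mu 1%E f -> in_Lp mu 1%E g ->
        {ae mu, forall w, f w = g w} -> {ae mu, forall w, U f w = U g w} &
      forall (a : R) f g, in_Lp mu 1%E f -> in_Lp mu 1%E g ->
        {ae mu, forall w, U (fun x => a *: f x + g x) w = a *: U f w + U g w}].

Definition L1_Loo_contraction d (T : measurableType d) (R : realType)
    (X : normedModType R) (mu : {measure set T -> \bar R})
    (U : (T -> X) -> (T -> X)) : Prop :=
  forall f, in_Lp mu 1%E f ->
    (Lpnorm mu 1%E (U f) <= Lpnorm mu 1%E f)%E /\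
    (Lpnorm mu +oo%E (U f) <= Lpnorm mu +oo%E f)%E.

(* Only the operators [U t] with [0 <= t] matter; continuity is only required
   at positive times. *)
Definition strongly_continuous_semigroup d (T : measurableType d)
    (R : realType) (X : normedModType R) (mu : {measure set T -> \bar R})
    (U : R -> (T -> X) -> (T -> X)) : Prop :=
  [/\ forall t, 0 <= t -> L1_operator mu (U t),
      forall f, in_Lp mu 1%E f -> {ae mu, forall w, U 0 f w = f w},
      forall t1 t2 f, 0 < t1 -> 0 < t2 -> in_Lp mu 1%E f ->
        {ae mu, forall w, U t1 (U t2 f) w = U (t1 + t2) f w} &
      forall f t2, in_Lp mu 1%E f -> 0 < t2 ->
        Lpnorm mu 1%E (fun w => U t1 f w - U t2 f w) @[t1 --> t2] --> 0%E].

Definition positively_dominated d (T : measurableType d)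
    (R : realType) (X : normedModType R) (mu : {measure set T -> \bar R})
    (U : R -> (T -> X) -> (T -> X)) (P : R -> (T -> R) -> (T -> R)) : Prop :=
  forall f t, in_Lp mu 1%E f -> 0 <= t ->
    {ae mu, forall w, `|U t f w| <= P t (fun x => `|f x|) w}.

(* A jointly measurable version of (tau, w) |-> U_tau f (w), as needed for
   the pointwise integral over tau of the L_1 classes U_tau f to make sense. *)
Definition joint_version d (T : measurableType d)
    (R : realType) (X : normedModType R) (mu : {measure set T -> \bar R})
    (U : R -> (T -> X) -> (T -> X)) (f : T -> X)
    (Uf : measurableTypeR R * T -> X) : Prop :=
  strongly_measurable measurable Uf /\
  {ae lebesgue_measure, forall tau : measurableTypeR R, 0 <= (tau : R) ->
    {ae mu, forall w, Uf (tau, w) = U tau f w}}.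

Definition ergodic_average (T : Type) (R : realType)
    (X : normedModType R) (Uf : measurableTypeR R * T -> X) (t : R) (w : T) :
    X :=
  t^-1 *: bochner lebesgue_measure (`[0, t] : set (measurableTypeR R))
            (fun tau => Uf (tau, w)).

(* S is the supremum, in the lattice of mu-a.e. classes of measurable
   functions, of the family (h i), i in I. For an uncountable family of
   functions each defined only almost everywhere, this is the meaning of
   "sup_i h_i": the pointwise supremum depends on the choice of versions. *)
Definition is_ae_sup d (T : measurableType d) (R : realType)
    (mu : {measure set T -> \bar R}) (J : Type) (I : set J)
    (h : J -> T -> \bar R) (S : T -> \bar R) : Prop :=
  [/\ measurable_fun setT S,
      forall i, I i -> {ae mu, forall w, (h i w <= S w)%E} &
      forall S' : T -> \bar R, measurable_fun setT S' ->
        (forall i, I i -> {ae mu, forall w, (h i w <= S' w)%E}) ->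
        {ae mu, forall w, (S w <= S' w)%E}].

(* Main.v *)
(* An essential supremum over (t, s) is the supremum of a countable subfamily,
   so only sequences (t_n, s_n) matter. Stopping the reverse martingale at the
   first index where the level l is exceeded gives Doob's inequality
   l mu{S > l} <= int_{S > l} v, with v = sup_n (1/t_n) int_0^{t_n} |T_tau f| dtau,
   and any pair (S, v) satisfying it for all l has |S|_p <= p/(p-1) |v|_p.
   For v, domination replaces T_tau f by P_tau |f|; the averages of P are
   approximated in L_1 by Cesaro means of the powers of P_{1/N}, to which Hopf's
   maximal lemma applies. It has the same form l mu{M > l} <= int_{M > l} |f|,
   whence |v|_p <= p/(p-1) |f|_p. The truncation of the L_1 error at a level K
   is small in L_p, so the bound survives the limit N -> oo. *)

Require Import Defs.
From HB Require Import structures.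
From mathcomp Require Import finmap.
From mathcomp Require Import all_boot all_order all_algebra.
From mathcomp Require Import all_classical all_reals all_analysis measurable_realfun.
From mathcomp Require Import ess_sup_inf.
From mathcomp Require Import ring lra.

Set Implicit Arguments.
Unset Strict Implicit.
Unset Printing Implicit Defensive.

Import Order.TTheory GRing.Theory Num.Theory.
Import numFieldNormedType.Exports.

Local Open Scope classical_set_scope.
Local Open Scope ring_scope.

(** X carries no order, so Hopf's argument cannot be run on T itself: only norms are compared with
    P, and positivity of P is extracted from domination by testing it on h e with e a unit vector.
    Hopf's lemma is discrete while the averages are integrals in time, and P_tau |f| is a separate
    class for each tau, with no joint measurability. The jointly measurable |Tf| is therefore
    compared with functions that are steps in time, and strong continuity controls the error in L_1
    only. This error has no maximal bound of its own, which is why it is handled for finitely many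
    times and under a truncation. The functions E(A_t f | F_s) do not form a martingale in (t, s);
    what replaces this is a single v dominating every |A_t f|. The constant p/(p-1) arises once over
    s and once over t, hence its square in (1). For (2) the L_p bound on S is bypassed: eps mu{S >=
    eps} is at most the integral of v, and Hölder's inequality bounds this by |v|_p mu(Omega)^(1 -
    1/p), so a single factor p/(p-1) remains. *)

(** * From weak-type to L_p bounds *)

(* Young's inequality [b a^(p-1) <= b^p / p + (p-1) a^p / p] in disguise. *)
Lemma powR_increment_le (R : realType) (p a b : R) : 1 < p -> 0 <= a -> a <= b ->
  b `^ p - a `^ p <= p / (p - 1) * (b * (b `^ (p - 1) - a `^ (p - 1))).
Proof.
move=> p1 a0 ab; have b0 := le_trans a0 ab.
have p0 : 0 < p by lra.
have pm : 0 < p - 1 by lra.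
have H : b * a `^ (p - 1) <= b `^ p / p + (a `^ (p - 1)) `^ (p / (p - 1)) / (p / (p - 1)).
  apply: conjugate_powR => //; first exact: powR_ge0.
  - exact: divr_gt0.
  - by field; rewrite !gt_eqF.
rewrite -powRrM in H.
have e1 : (p - 1) * (p / (p - 1)) = p by field; rewrite gt_eqF.
rewrite e1 in H.
rewrite mulrBr mulr_powRB1//.
have H2 : p / (p - 1) * (b * a `^ (p - 1)) <= p / (p - 1) *
    (b `^ p / p + a `^ p / (p / (p - 1))).
  by rewrite ler_wpM2l// ltW// divr_gt0.
have e2 : p / (p - 1) * (b `^ p / p + a `^ p / (p / (p - 1))) =
  b `^ p / (p - 1) + a `^ p.
  by field; rewrite !gt_eqF.
rewrite e2 in H2.
have e3 : p / (p - 1) * b `^ p = b `^ p + b `^ p / (p - 1).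
  by field; rewrite gt_eqF.
rewrite mulrBr e3; lra.
Qed.

(* Sums over the levels [e r^j] replace the layer-cake integral over all levels
   in the passage from weak-type to L_p bounds; then e -> 0 and r -> 1. *)
Section geometric_grid.
Variables (R : realType) (p e r : R).
Hypotheses (p1 : 1 < p) (e0 : 0 < e) (r1 : 1 < r).

Let lam (j : nat) := e * r ^+ j.
Let dlt (j : nat) := lam j.+1 `^ (p - 1) - lam j `^ (p - 1).

Let r0 : 0 < r. Proof. by apply: lt_trans r1. Qed.

Let lam_gt0 j : 0 < lam j.
Proof. by rewrite mulr_gt0// exprn_gt0. Qed.

Let lamS j : lam j.+1 = r * lam j.
Proof. by rewrite /lam exprS mulrCA. Qed.

Let lam_ltS j : lam j < lam j.+1.
Proof. by rewrite lamS ltr_pMl. Qed.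

Let lam_le i j : (i <= j)%N -> lam i <= lam j.
Proof. by move=> ij; rewrite /lam ler_pM2l// ler_weXn2l// ltW. Qed.

Lemma geometric_grid_dlt_ge0 j : 0 <= dlt j.
Proof.
have pm : 0 <= p - 1 by rewrite subr_ge0 ltW.
by rewrite subr_ge0 ge0_ler_powR ?nnegrE// ltW.
Qed.

(** The terms with [lam j] below x telescope to at most the (p-1)-th power of the level just after
    the last of them, and that level is at most r x. *)
Lemma geometric_grid_upper (x : R) J : 0 <= x ->
  \sum_(j < J) dlt j * (lam j < x)%R%:R <= (r * x) `^ (p - 1).
Proof.
move=> x0; elim: J => [|J IH]; first by rewrite big_ord0 powR_ge0.
have [Jx|xJ] := ltP (lam J) x; last first.
  by rewrite big_ord_recr/= ltNge xJ/= mulr0 addr0.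
have -> : \sum_(j < J.+1) dlt j * (lam j < x)%R%:R = lam J.+1 `^ (p - 1) - lam 0 `^ (p - 1).
  rewrite -(telescope_sumr (fun j => lam j `^ (p - 1)))// big_mkord.
  apply: eq_bigr => i _; rewrite (le_lt_trans _ Jx) ?mulr1//.
  by apply: lam_le; rewrite -ltnS.
rewrite (@le_trans _ _ (lam J.+1 `^ (p - 1)))//.
  by rewrite lerBlDr lerDl powR_ge0.
have pm : 0 <= p - 1 by rewrite subr_ge0 ltW.
have ? := ltW r0; have ? := ltW (lam_gt0 J).
rewrite lamS; apply: ge0_ler_powR; rewrite ?nnegrE//.
- exact: mulr_ge0.
- exact: mulr_ge0.
- by apply: ler_wpM2l => //; exact: ltW.
Qed.

Lemma geometric_grid_lower (x : R) J : 0 <= x -> x <= lam J ->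
  x `^ p <= e `^ p + p / (p - 1) * r * \sum_(j < J) lam j * (dlt j * (lam j < x)%R%:R).
Proof.
move=> x0 xJ.
have pm : 0 < p - 1 by rewrite subr_gt0.
have pp : 0 <= p by rewrite ltW// (lt_trans ltr01).
(* Capping x at [lam J] opens an induction on J: a new level raises the cap only while x exceeds
   [lam J], which is exactly when its term is present. *)
suff H : Num.min x (lam J) `^ p <=
    e `^ p + p / (p - 1) * r * \sum_(j < J) lam j * (dlt j * (lam j < x)%R%:R).
  by rewrite -[x in x `^ p](min_l xJ).
elim: J {xJ} => [|J IH].
  rewrite big_ord0 mulr0 addr0 ge0_ler_powR ?nnegrE//.
  - by rewrite le_min x0 ltW.
  - exact: ltW.
  - by rewrite {1}/lam expr0 mulr1 ge_min lexx orbT.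
rewrite big_ord_recr/=.
have [Jx|xJ] := ltP (lam J) x; last first.
  rewrite mulr0 mulr0 addr0.
  rewrite (min_l xJ) in IH.
  by rewrite min_l// (le_trans xJ)// ltW.
rewrite (min_r (ltW Jx)) in IH.
rewrite mulr1 mulrDr addrA.
have H := powR_increment_le p1 (ltW (lam_gt0 J)) (ltW (lam_ltS J)).
(* The increment of the p-th power is bounded with the upper end [lam J.+1] of the step, the sum
   uses the lower end [lam J]; their ratio is the factor r. *)
have -> : p / (p - 1) * r * (lam J * dlt J) =
    p / (p - 1) * (lam J.+1 * dlt J) by rewrite lamS; ring.
apply: (@le_trans _ _ (lam J.+1 `^ p)).
  rewrite ge0_ler_powR ?nnegrE//.
  - by rewrite le_min x0 ltW.
  - exact: ltW.
  - by rewrite ge_min lexx orbT.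
by rewrite -/(dlt J) in H; lra.
Qed.

End geometric_grid.

Lemma exists_expr_ge (R : archiRealFieldType) (r x : R) : 1 < r ->
  exists n, x <= r ^+ n.
Proof.
move=> r1.
(* A weakened Bernoulli inequality. *)
have B n : n%:R * (r - 1) <= r ^+ n.
  elim: n => [|n IH]; first by rewrite mul0r expr0 ler01.
  have rn1 : 1 <= r ^+ n by rewrite exprn_ege1// ltW.
  rewrite exprS -natr1 mulrDl mul1r.
  have -> : r * r ^+ n = r ^+ n + (r - 1) * r ^+ n by ring.
  by rewrite lerD// ler_peMr// subr_ge0 ltW.
exists (Num.bound `|x / (r - 1)|).
apply: le_trans (B _).
rewrite -ler_pdivrMr ?subr_gt0//.
by rewrite (le_trans (ler_norm _))// ltW// archi_boundP.
Qed.

Section maximal_inequality.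
Context d (T : measurableType d) (R : realType).
Variable mu : {finite_measure set T -> \bar R}.
Local Open Scope ereal_scope.

(** A discrete layer-cake argument: [geometric_grid_lower] expands M^p over the levels, the
    weak-type hypothesis is applied at each level, and [geometric_grid_upper] sums them back to
    M^(p-1). The first costs a factor r and the last r^(p-1), whence r^p. The bound K makes finitely
    many levels enough. *)
Lemma maximal_powR_approx (p K e r : R) (M h : T -> R) :
  (1 < p)%R -> (0 < e)%R -> (1 < r)%R ->
  measurable_fun setT M -> measurable_fun setT h ->
  (forall w, 0 <= M w <= K)%R -> (forall w, 0 <= h w)%R ->
  (forall l : R, (0 < l)%R -> l%:E * mu [set w | (l < M w)%R] <=
     \int[mu]_(w in [set w | (l < M w)%R]) (h w)%:E) ->
  \int[mu]_w (M w `^ p)%:E <= (e `^ p)%:E * mu setT +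
    (p / (p - 1) * r `^ p)%:E * \int[mu]_w (h w * M w `^ (p - 1))%:E.
Proof.
move=> p1 e0 r1 mM mh MK h0 wk.
have p0 : (0 < p)%R by rewrite (lt_trans ltr01).
have pm : (0 < p - 1)%R by rewrite subr_gt0.
have r0 : (0 < r)%R by rewrite (lt_trans ltr01).
have [J KJ] := exists_expr_ge (K / e) r1.
rewrite ler_pdivrMr// mulrC in KJ.
pose lam j := (e * r ^+ j)%R.
pose dlt j := (lam j.+1 `^ (p - 1) - lam j `^ (p - 1))%R.
have lam0 j : (0 < lam j)%R by rewrite mulr_gt0// exprn_gt0.
have dlt0 j : (0 <= dlt j)%R by exact: geometric_grid_dlt_ge0.
pose A j := [set w | (lam j < M w)%R].
have mA j : measurable (A j).
  rewrite -[A j]setTI; exact: measurable_fun_ltr.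
pose c j := (p / (p - 1) * r * dlt j)%R.
have c0 j : (0 <= c j)%R.
  by rewrite /c !mulr_ge0// ?invr_ge0 ltW.
have cl0 j : (0 <= c j * lam j)%R := mulr_ge0 (c0 j) (ltW (lam0 j)).
have indE j w : ((lam j < M w)%R%:R = \1_(A j) w :> R)%R.
  rewrite indicE; congr (_%:R)%R; apply/esym; congr nat_of_bool.
  by apply/idP/idP; rewrite inE.
apply: (@le_trans _ _ (\int[mu]_w ((e `^ p)%:E +
    \sum_(j < J) (c j * lam j)%:E * (\1_(A j) w)%:E))).
  apply: ge0_le_integral => //.
  - by move=> w _; rewrite lee_fin powR_ge0.
  - by apply/measurable_EFinP; exact: (measurableT_comp (@measurable_powR R p) mM).
  - apply: emeasurable_funD => //; apply: emeasurable_sum => j.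
    by apply: measurable_funeM; apply/measurable_EFinP; exact: measurable_indic.
  - move=> w _.
    under eq_bigr do rewrite -EFinM.
    rewrite sumEFin -EFinD lee_fin.
    have /andP[Mw0 MwK] := MK w.
    have := geometric_grid_lower p1 e0 r1 Mw0 (le_trans MwK KJ).
    move/le_trans; apply; rewrite lerD2l mulr_sumr.
    apply: ler_sum => j _; rewrite -indE /c -/(lam j) -/(dlt j).
    have -> (a b l x t : R) : (a * b * (l * (x * t)) = a * b * x * l * t)%R by ring.
    by [].
rewrite ge0_integralD//; last 3 first.
  - by move=> w _; rewrite lee_fin powR_ge0.
  - move=> w _; apply: sume_ge0 => j _; rewrite -EFinM lee_fin.
    by rewrite mulr_ge0.
  - apply: emeasurable_sum => j.
    by apply: measurable_funeM; apply/measurable_EFinP; exact: measurable_indic.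
rewrite integral_cst//; apply: leeD => //.
rewrite ge0_integral_sum//; last 2 first.
  - by move=> j; apply: measurable_funeM; apply/measurable_EFinP; exact: measurable_indic.
  - by move=> j w _; rewrite -EFinM lee_fin mulr_ge0.
apply: (@le_trans _ _ (\sum_(j < J) \int[mu]_w (c j * (h w * \1_(A j) w))%:E)).
  apply: lee_sum => j _.
  under [leRHS]eq_integral do rewrite EFinM.
  have mI : measurable_fun setT (EFin \o \1_(A j) : T -> \bar R).
    by apply/measurable_EFinP; exact: measurable_indic.
  rewrite ge0_integralZl_EFin//.
  rewrite ge0_integralZl_EFin//; last 2 first.
  - by move=> w _; rewrite lee_fin mulr_ge0.
  - by apply/measurable_EFinP; apply: measurable_funM => //; exact: measurable_indic.
  rewrite integral_indic// setIT EFinM -muleA lee_wpmul2l ?lee_fin//.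
  apply: le_trans (wk _ (lam0 j)) _.
  rewrite [leLHS]integral_mkcond epatch_indic.
  by under eq_integral do rewrite -EFinM.
rewrite -ge0_integral_sum//; last 2 first.
  - move=> j; apply/measurable_EFinP; apply: measurable_funM => //.
    by apply: measurable_funM => //; exact: measurable_indic.
  - by move=> j w _; rewrite lee_fin mulr_ge0// mulr_ge0.
have mhM : measurable_fun setT (fun w => (h w * M w `^ (p - 1))%R).
  apply: measurable_funM => //.
  by apply: (measurableT_comp (measurable_powR _)).
rewrite -ge0_integralZl_EFin//; last 3 first.
  - by move=> w _; rewrite lee_fin mulr_ge0// powR_ge0.
  - exact/measurable_EFinP.
  - by rewrite mulr_ge0 ?powR_ge0// divr_ge0// ltW.
apply: ge0_le_integral => //.
- by move=> w _; apply: sume_ge0 => j _; rewrite lee_fin mulr_ge0// mulr_ge0.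
- apply: emeasurable_sum => j; apply/measurable_EFinP; apply: measurable_funM => //.
  by apply: measurable_funM => //; exact: measurable_indic.
- by apply/measurable_EFinP; apply: measurable_funM.
move=> w _; rewrite sumEFin -EFinM lee_fin.
have /andP[Mw0 _] := MK w.
have H := geometric_grid_upper p1 e0 r1 J Mw0.
have -> : (\sum_(j < J) c j * (h w * \1_(A j) w) =
    p / (p - 1) * r * h w * \sum_(j < J) dlt j * (lam j < M w)%R%:R)%R.
  rewrite mulr_sumr; apply: eq_bigr => j _; rewrite indE /c; ring.
have -> : (p / (p - 1) * r `^ p * (h w * M w `^ (p - 1)) =
    p / (p - 1) * r * h w * (r * M w) `^ (p - 1))%R.
  rewrite powRM// ?ltW// -(mulr_powRB1 (ltW r0) p0); ring.
by apply: ler_wpM2l => //; rewrite !mulr_ge0// ?invr_ge0 ltW.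
Qed.

End maximal_inequality.

Section maximal_inequality_bounded.
Context d (T : measurableType d) (R : realType).
Variable mu : {finite_measure set T -> \bar R}.
Local Open Scope ereal_scope.

Lemma integral_powR_bounded_lty (p K : R) (M : T -> R) : (0 <= p)%R ->
  measurable_fun setT M -> (forall w, 0 <= M w <= K)%R ->
  \int[mu]_w (M w `^ p)%:E < +oo.
Proof.
move=> p0 mM MK.
apply: (@le_lt_trans _ _ (\int[mu]_w (cst (K `^ p)%:E w))).
  apply: ge0_le_integral => //.
  - by move=> w _; rewrite lee_fin powR_ge0.
  - by apply/measurable_EFinP; exact: (measurableT_comp (@measurable_powR R p) mM).
  - move=> w _; have /andP[M0 MwK] := MK w.
    by rewrite lee_fin ge0_ler_powR ?nnegrE// (le_trans M0).
rewrite integral_cst// lte_mul_pinfty ?lee_fin ?powR_ge0//.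
by rewrite -ge0_fin_numE// fin_num_measure.
Qed.

(** The limit e -> 0, r -> 1 of the preceding estimate, with both driven by one parameter [dd]
    through e^p = dd and r^p = 1 + dd. *)
Lemma maximal_powR (p K : R) (M h : T -> R) :
  (1 < p)%R ->
  measurable_fun setT M -> measurable_fun setT h ->
  (forall w, 0 <= M w <= K)%R -> (forall w, 0 <= h w)%R ->
  (forall l : R, (0 < l)%R -> l%:E * mu [set w | (l < M w)%R] <=
     \int[mu]_(w in [set w | (l < M w)%R]) (h w)%:E) ->
  \int[mu]_w (M w `^ p)%:E <=
    (p / (p - 1))%:E * \int[mu]_w (h w * M w `^ (p - 1))%:E.
Proof.
move=> p1 mM mh MK h0 wk.
have p0 : (0 < p)%R by rewrite (lt_trans ltr01).
have pm : (0 < p - 1)%R by rewrite subr_gt0.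
have q0 : (0 < p / (p - 1))%R by rewrite divr_gt0.
have X0 : 0 <= \int[mu]_w (M w `^ p)%:E.
  by apply: integral_ge0 => w _; rewrite lee_fin powR_ge0.
have Y0 : 0 <= \int[mu]_w (h w * M w `^ (p - 1))%:E.
  by apply: integral_ge0 => w _; rewrite lee_fin mulr_ge0// powR_ge0.
have Xoo := integral_powR_bounded_lty (ltW p0) mM MK.
have H e r e0 r1 := @maximal_powR_approx _ _ _ mu p K e r M h p1 e0 r1 mM mh MK h0 wk.
have [Yoo|] := eqVneq (\int[mu]_w (h w * M w `^ (p - 1))%:E) +oo.
  by rewrite Yoo gt0_muley ?lte_fin// leey.
rewrite -ltey => Yoo.
have mfin : mu setT \is a fin_num by rewrite fin_num_measure.
move: X0 Y0 Xoo Yoo H mfin.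
case: (\int[mu]_w (M w `^ p)%:E) => [x| |]// x0 + _.
case: (\int[mu]_w (h w * M w `^ (p - 1))%:E) => [y| |]// y0 _ H mfin.
rewrite -(fineK mfin) in H.
set m := fine (mu setT) in H.
have m0 : (0 <= m)%R by rewrite fine_ge0.
rewrite lee_fin in y0.
rewrite -EFinM lee_fin; apply/ler_addgt0Pr => eps eps0.
set q := (p / (p - 1))%R in q0 H *.
(* The excess over the limit is dd (m + q y); the added 1 keeps the denominator of [dd] positive
   when m + q y vanishes. *)
have C0 : (0 < m + q * y + 1)%R.
  by rewrite ltr_pwDr// addr_ge0// mulr_ge0// ltW.
set dd := (eps / (m + q * y + 1))%R.
have dd0 : (0 < dd)%R by rewrite divr_gt0.
have := H (dd `^ p^-1)%R ((1 + dd) `^ p^-1)%R.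
rewrite -!powRrM mulVf ?gt_eqF// !powRr1 ?addr_ge0 ?(ltW dd0)//.
rewrite powR_gt0// => /(_ isT).
have -> : (1 < (1 + dd) `^ p^-1)%R.
  have E1 : (1 `^ p^-1 = 1 :> R)%R by rewrite powR1.
  rewrite -[ltLHS]E1 gt0_ltr_powR ?invr_gt0 ?nnegrE ?ltrDl//.
  by rewrite addr_ge0// ltW.
move=> /(_ isT); rewrite -!EFinM -EFinD lee_fin => /le_trans; apply.
have -> : (dd * m + q * (1 + dd) * y = q * y + dd * (m + q * y))%R by ring.
rewrite lerD2l /dd -mulrA ler_piMr ?(ltW eps0)//.
by rewrite mulrC ler_pdivrMr// mul1r lerDl.
Qed.

(** Hölder's inequality with exponents p and p/(p-1) bounds |M|_p^p by p/(p-1) |h|_p |M|_p^(p-1).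
    Dividing by the last factor requires it to be finite, which the bound K secures. *)
Lemma maximal_Lnorm_bounded (p K : R) (M h : T -> R) :
  (1 < p)%R ->
  measurable_fun setT M -> measurable_fun setT h ->
  (forall w, 0 <= M w <= K)%R -> (forall w, 0 <= h w)%R ->
  (forall l : R, (0 < l)%R -> l%:E * mu [set w | (l < M w)%R] <=
     \int[mu]_(w in [set w | (l < M w)%R]) (h w)%:E) ->
  'N[mu]_p%:E[EFin \o M] <= (p / (p - 1))%:E * 'N[mu]_p%:E[EFin \o h].
Proof.
move=> p1 mM mh MK h0 wk.
have p0 : (0 < p)%R by rewrite (lt_trans ltr01).
have pN0 : p != 0%R by rewrite gt_eqF.
have pm : (0 < p - 1)%R by rewrite subr_gt0.
have pmN0 : (p - 1 != 0)%R by rewrite gt_eqF.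
have q0 : (0 < p / (p - 1))%R by rewrite divr_gt0.
have M0 w : (0 <= M w)%R by case/andP: (MK w).
have mMp : measurable_fun setT (fun w => M w `^ (p - 1))%R.
  exact: (measurableT_comp (@measurable_powR R (p - 1)) mM).
have NM : 'N[mu]_p%:E[EFin \o M] = (\int[mu]_w (M w `^ p)%:E) `^ p^-1.
  rewrite unlock; congr (_ `^ _); apply: eq_integral => w _ /=.
  by rewrite ger0_norm.
have NMq : 'N[mu]_(p / (p - 1))%:E[EFin \o (fun w => M w `^ (p - 1))%R] =
    (\int[mu]_w (M w `^ p)%:E) `^ (p / (p - 1))^-1.
  rewrite unlock; congr (_ `^ _); apply: eq_integral => w _ /=.
  rewrite ger0_norm ?powR_ge0// -powRrM; congr ((_ `^ _)%:E).
  by field.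
have N1 : 'N[mu]_1[EFin \o (h \* (fun w => M w `^ (p - 1)))%R] =
    \int[mu]_w (h w * M w `^ (p - 1))%:E.
  rewrite Lnorm1; apply: eq_integral => w _ /=.
  by rewrite ger0_norm// mulr_ge0// powR_ge0.
have hq : (p^-1 + (p / (p - 1))^-1 = 1)%R by field; rewrite pN0 pmN0.
have := @hoelder _ _ _ mu _ _ _ _ mh mMp p0 q0 hq.
rewrite N1 NMq => H1.
have H2 := maximal_powR p1 mM mh MK h0 wk.
have {H1 H2} H := le_trans H2 (lee_wpmul2l (ltW q0 : 0 <= (p / (p - 1))%:E) H1).
have X0 : 0 <= \int[mu]_w (M w `^ p)%:E.
  by apply: integral_ge0 => w _; rewrite lee_fin powR_ge0.
have Xoo := integral_powR_bounded_lty (ltW p0) mM MK.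
rewrite NM.
have [Noo|] := eqVneq ('N[mu]_p%:E[EFin \o h]) +oo.
  by rewrite Noo gt0_muley ?lte_fin// leey.
rewrite -ltey => Noo.
have := Lnorm_ge0 mu p%:E (EFin \o h).
move: X0 Xoo H Noo.
case: (\int[mu]_w (M w `^ p)%:E) => [x| |]// x0 _ + +.
case: ('N[mu]_p%:E[EFin \o h]) => [n| |]// + _ n0.
rewrite !poweR_EFin -!EFinM !lee_fin in x0 n0 * => H.
move: x0; rewrite le_eqVlt => /predU1P[<-|x0].
  by rewrite powR0 ?invr_eq0// mulr_ge0// ltW.
have xq0 : (0 < x `^ (p / (p - 1))^-1)%R by rewrite powR_gt0.
rewrite -(ler_pM2r xq0) -powRD ?(gt_eqF x0) ?implybT//.
rewrite hq powRr1; last exact: ltW.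
by rewrite -mulrA.
Qed.

End maximal_inequality_bounded.

(** * Powers, truncations and monotone limits in the extended reals *)

Lemma poweR_invK (R : realType) (p : R) (x : \bar R) : p != 0 -> (0 <= x)%E ->
  ((x `^ p) `^ p^-1 = x)%E.
Proof. by move=> p0 x0; rewrite -poweRrM mulfV// poweRe1. Qed.

Lemma poweRK_inv (R : realType) (p : R) (x : \bar R) : p != 0 -> (0 <= x)%E ->
  ((x `^ p^-1) `^ p = x)%E.
Proof. by move=> p0 x0; rewrite -poweRrM mulVf// poweRe1. Qed.

Lemma ge0_le_poweR (R : realType) (p : R) (x y : \bar R) : 0 <= p ->
  (0 <= x -> x <= y -> x `^ p <= y `^ p)%E.
Proof.
move=> p0 x0 xy; apply: gt0_ler_poweR => //.
- by rewrite in_itv/= x0 leey.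
- by rewrite in_itv/= (le_trans x0 xy) leey.
Qed.

Lemma ereal_sup_poweR (R : realType) (p : R) (u : (\bar R)^nat) : 0 < p ->
  (forall n, 0 <= u n)%E ->
  ((ereal_sup (range u)) `^ p = ereal_sup (range (fun n => (u n) `^ p)))%E.
Proof.
move=> p0 u0; have pN0 : p != 0 by rewrite gt_eqF.
have s0 : (0 <= ereal_sup (range u))%E.
  by apply: le_trans (u0 0%N) _; apply: ereal_sup_ubound; exists 0%N.
have t0 : (0 <= ereal_sup (range (fun n => (u n) `^ p)))%E.
  by apply: le_trans (poweR_ge0 (u 0%N) p) _; apply: ereal_sup_ubound; exists 0%N.
apply/eqP; rewrite eq_le; apply/andP; split; last first.
  apply: ge_ereal_sup => _ [n _ <-]; apply: ge0_le_poweR => //; first exact: ltW.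
  by apply: ereal_sup_ubound; exists n.
rewrite -[leRHS](@poweRK_inv _ p)//; apply: ge0_le_poweR => //; first exact: ltW.
apply: ge_ereal_sup => _ [n _ <-].
rewrite -[leLHS](@poweR_invK _ p)//; apply: ge0_le_poweR; rewrite ?poweR_ge0//.
  by rewrite invr_ge0 ltW.
by apply: ereal_sup_ubound; exists n.
Qed.

Lemma ereal_sup_mine_nat (R : realType) (x : \bar R) : (0 <= x)%E ->
  ereal_sup (range (fun n => mine x n%:R%:E)) = x.
Proof.
move=> x0; apply/eqP; rewrite eq_le; apply/andP; split.
  by apply: ge_ereal_sup => _ [n _ <-]; rewrite ge_min lexx.
have [->|] := eqVneq x +oo%E.
  rewrite leye_eq; apply/eqP/eqyP => A A0.
  apply: le_ereal_sup_tmp; exists (mine +oo (Num.bound A)%:R%:E)%E.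
    by exists (Num.bound A).
  by rewrite min_r ?leey// lee_fin ltW// archi_boundP// ltW.
rewrite -ltey -ge0_fin_numE// => xfin.
apply: le_ereal_sup_tmp; exists (mine x (Num.bound (fine x))%:R%:E).
  by exists (Num.bound (fine x)).
rewrite min_l// -{1}(fineK xfin) lee_fin ltW// archi_boundP//.
exact: fine_ge0.
Qed.

Lemma ae_eq_Lnorm d (T : measurableType d) (R : realType)
    (mu : {measure set T -> \bar R}) (p : R) (f g : T -> \bar R) :
  measurable_fun setT f -> measurable_fun setT g ->
  {ae mu, forall w, f w = g w} -> ('N[mu]_p%:E[f] = 'N[mu]_p%:E[g])%E.
Proof.
move=> mf mg fg; rewrite unlock; congr (_ `^ _)%E.
apply: ae_eq_integral => //.
- apply: (measurableT_comp (measurable_poweR p)).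
  exact: (measurableT_comp (@abse_measurable R setT)).
- apply: (measurableT_comp (measurable_poweR p)).
  exact: (measurableT_comp (@abse_measurable R setT)).
- by apply: filterS fg => w /= -> _.
Qed.

Lemma Lnorm_lty_ae_fin d (T : measurableType d) (R : realType)
    (mu : {measure set T -> \bar R}) (p : R) (f : T -> \bar R) : 0 < p ->
  measurable_fun setT f -> (forall w, 0 <= f w)%E -> ('N[mu]_p%:E[f] < +oo)%E ->
  {ae mu, forall w, f w = (fine (f w))%:E}.
Proof.
move=> p0 mf f0 foo; have pN0 : p != 0 by rewrite gt_eqF.
have ifp : mu.-integrable setT (fun w => f w `^ p)%E.
  apply/integrableP; split; first exact: (measurableT_comp (measurable_poweR p) mf).
  under eq_integral do rewrite gee0_abs ?poweR_ge0//.
  rewrite (_ : (\int[mu]_w _ = 'N[mu]_p%:E[f] `^ p)%E); first exact: poweR_lty.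
  by rewrite poweR_Lnorm//; apply: eq_integral => w _; rewrite gee0_abs.
have := integrable_ae measurableT ifp; apply: filterS => w /(_ I) fw.
rewrite fineK// ge0_fin_numE//; apply: (@lty_poweRy _ _ p) => //.
by rewrite -ge0_fin_numE// poweR_ge0.
Qed.

Section maximal_inequality_ereal.
Context d (T : measurableType d) (R : realType).
Local Open Scope ereal_scope.

Lemma measurable_fun_ereal_sup (u : nat -> T -> \bar R) :
  (forall n, measurable_fun setT (u n)) ->
  measurable_fun setT (fun w => ereal_sup (range (u ^~ w))).
Proof.
move=> mu_; have := measurable_fun_esups mu_ 0.
apply: eq_measurable_fun => w _ /=; rewrite /esups/= /sdrop.
by congr (ereal_sup (_ @` _)); apply/seteqP; split.
Qed.

(** Monotone convergence: it carries a uniform L_p bound from truncations, or from finite maxima, to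
    the supremum. *)
Lemma Lnorm_ereal_sup_le (mu : {measure set T -> \bar R}) (p : R)
    (u : nat -> T -> \bar R) (C : \bar R) : (0 < p)%R ->
  (forall n, measurable_fun setT (u n)) -> (forall n w, 0 <= u n w) ->
  (forall w, nondecreasing_seq (u ^~ w)) ->
  (forall n, 'N[mu]_p%:E[u n] <= C) ->
  'N[mu]_p%:E[(fun w => ereal_sup (range (u ^~ w)))] <= C.
Proof.
move=> p0 mu_ u0 nd uC; have pN0 : p != 0%R by rewrite gt_eqF.
have C0 : 0 <= C by apply: le_trans (uC 0%N); exact: Lnorm_ge0.
have sup0 w : 0 <= ereal_sup (range (u ^~ w)).
  by apply: le_trans (u0 0%N w) _; apply: ereal_sup_ubound; exists 0%N.
have mup n : measurable_fun setT (fun w => u n w `^ p).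
  exact: (measurableT_comp (measurable_poweR p) (mu_ n)).
have ndp w : nondecreasing_seq (fun n => u n w `^ p).
  by move=> m n mn; apply: ge0_le_poweR => //; [exact: ltW|exact: nd].
suff H : \int[mu]_w (ereal_sup (range (u ^~ w)) `^ p) <= C `^ p.
  rewrite unlock; under eq_integral do rewrite gee0_abs//.
  rewrite -[leRHS](@poweR_invK _ p)//; apply: ge0_le_poweR => //.
    by rewrite invr_ge0 ltW.
  by apply: integral_ge0 => w _; exact: poweR_ge0.
have E w : ereal_sup (range (u ^~ w)) `^ p = limn (fun n => u n w `^ p).
  rewrite (ereal_sup_poweR p0)//.
  by apply/esym/cvg_lim => //; apply: ereal_nondecreasing_cvgn.
under eq_integral do rewrite E.
rewrite monotone_convergence//; last by move=> n w _; exact: poweR_ge0.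
apply: lime_le.
  apply: ereal_nondecreasing_is_cvgn => m n mn; apply: ge0_le_integral => //.
  - by move=> w _; exact: poweR_ge0.
  - by move=> w _; exact: ndp.
apply: nearW => n.
rewrite (_ : \int[mu]_w _ = 'N[mu]_p%:E[u n] `^ p).
  by apply: ge0_le_poweR => //; [exact: ltW|exact: Lnorm_ge0].
by rewrite poweR_Lnorm//; apply: eq_integral => w _; rewrite gee0_abs.
Qed.


(** Truncating M at n preserves the weak-type hypothesis with the same h: for l < n the level sets
    of the truncation and of M coincide, and for l >= n the former is empty. If |h|_p is finite, h
    is real almost everywhere and the bounded case applies. *)
Lemma maximal_Lnorm (mu : {finite_measure set T -> \bar R}) (p : R)
    (M h : T -> \bar R) : (1 < p)%R ->
  measurable_fun setT M -> measurable_fun setT h ->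
  (forall w, 0 <= M w) -> (forall w, 0 <= h w) ->
  (forall l : R, (0 < l)%R -> l%:E * mu [set w | l%:E < M w] <=
     \int[mu]_(w in [set w | l%:E < M w]) h w) ->
  'N[mu]_p%:E[M] <= (p / (p - 1))%:E * 'N[mu]_p%:E[h].
Proof.
move=> p1 mM mh M0 h0 wk.
have p0 : (0 < p)%R by rewrite (lt_trans ltr01).
have pN0 : p != 0%R by rewrite gt_eqF.
have q0 : (0 < p / (p - 1))%R by rewrite divr_gt0// subr_gt0.
have [Noo|] := eqVneq ('N[mu]_p%:E[h]) +oo.
  by rewrite Noo gt0_muley ?lte_fin// leey.
rewrite -ltey => Noo.
have hfin := Lnorm_lty_ae_fin p0 mh h0 Noo.
have mfh : measurable_fun setT (fine \o h : T -> R).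
  by apply: measurableT_comp => //; exact: fine_measurable.
have Nh : 'N[mu]_p%:E[h] = 'N[mu]_p%:E[EFin \o (fine \o h)].
  by apply: ae_eq_Lnorm => //; exact/measurable_EFinP.
pose u n w := mine (M w) n%:R%:E.
have u0 n w : 0 <= u n w by rewrite /u le_min M0/= lee_fin.
have mu_ n : measurable_fun setT (u n).
  exact: measurable_mine.
have uE n w : u n w = (fine (u n w))%:E.
  rewrite fineK// ge0_fin_numE// /u.
  by rewrite (le_lt_trans _ (ltry n%:R))// ge_min lexx orbT.
have -> : M = (fun w => ereal_sup (range (u ^~ w))).
  by apply/funext => w; rewrite /u ereal_sup_mine_nat.
apply: Lnorm_ereal_sup_le => //.
  move=> w m n mn; rewrite /u le_min ge_min lexx/=.
  by rewrite ge_min lee_fin ler_nat mn orbT.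
move=> n; rewrite Nh.
have -> : u n = EFin \o (fine \o u n) by apply/funext => w /=.
apply: (@maximal_Lnorm_bounded _ _ _ mu p n%:R) => //.
- by apply: measurableT_comp => //; exact: fine_measurable.
- move=> w; rewrite -!lee_fin -uE u0/=.
  by rewrite /u ge_min lexx orbT.
- by move=> w /=; apply: fine_ge0.
move=> l l0.
have [nl|ln] := leP n%:R l.
  rewrite (_ : [set w | _] = set0) ?measure0 ?mule0 ?integral_set0//.
  apply/seteqP; split => // w /=; rewrite -lte_fin -uE /u lt_min => /andP[_].
  by rewrite lte_fin ltNge nl.
have -> : [set w | (l < (fine \o u n) w)%R] = [set w | l%:E < M w].
  apply/seteqP; split => w /=; rewrite -lte_fin -uE /u lt_min.
    by case/andP.
  by move=> ->; rewrite lte_fin.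
apply: le_trans (wk _ l0) _; rewrite le_eqVlt; apply/orP; left; apply/eqP.
apply: ae_eq_integral => //.
- rewrite -[X in measurable X]setTI; exact: emeasurable_fun_o_infty.
- exact: measurable_funTS.
- by apply/measurable_EFinP; exact: measurable_funTS.
- by apply: filterS hfin => w /= {1}-> _.
Qed.

End maximal_inequality_ereal.

(** * The Bochner integral *)

Lemma fset_set_rangeP (T : Type) (Y : choiceType) (phi : T -> Y) w :
  finite_set (range phi) -> phi w \in fset_set (range phi).
Proof. by move=> fphi; rewrite in_fset_set// inE; exists w. Qed.

Section finite_range.
Context d (T : measurableType d) (Y : choiceType) (phi : T -> Y).
Hypothesis fphi : finite_set (range phi).
Hypothesis mphi : forall y, measurable (phi @^-1` [set y]).

Lemma measurable_finite_range_preimage (A : set Y) : measurable (phi @^-1` A).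
Proof.
rewrite (_ : phi @^-1` A = \bigcup_(y in range phi `&` A) (phi @^-1` [set y])).
  by apply: fin_bigcup_measurable => //; exact: finite_setIl.
apply/seteqP; split => [w Aw|w [y [_ Ay] /= yw]]; last by rewrite /= yw.
by exists (phi w) => //; split => //; exists w.
Qed.

Lemma measurable_finite_range d' (Z : measurableType d') (g : Y -> Z) :
  measurable_fun setT (g \o phi).
Proof.
move=> _ A mA; rewrite setTI comp_preimage.
exact: measurable_finite_range_preimage.
Qed.

Lemma finite_range_comp (Z : Type) (g : Y -> Z) : finite_set (range (g \o phi)).
Proof. by have := finite_image g fphi; rewrite image_comp. Qed.

End finite_range.

Section simple_integral.
Context d (T : measurableType d) (R : realType).
Variables (mu : {measure set T -> \bar R}) (D : set T).
Hypotheses (mD : measurable D) (muD : (mu D < +oo)%E).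

Let mass A : measurable A -> mu (D `&` A) \is a fin_num.
Proof.
move=> mA; rewrite ge0_fin_numE//; apply: le_lt_trans muD.
by apply: le_measure; rewrite ?inE//; exact: measurableI.
Qed.

Section pushforward.
Context (Y : choiceType) (phi : T -> Y).
Hypothesis fphi : finite_set (range phi).
Hypothesis mphi : forall y, measurable (phi @^-1` [set y]).

Lemma integral_finite_range (g : Y -> R) : (forall y, 0 <= g y) ->
  (\int[mu]_(w in D) (g (phi w))%:E =
   (\sum_(y <- fset_set (range phi)) fine (mu (D `&` phi @^-1` [set y])) * g y)%:E)%E.
Proof.
move=> g0.
have E w : (g (phi w))%:E = (\sum_(y <- fset_set (range phi))
    (g y)%:E * (\1_(phi @^-1` [set y]) w)%:E)%E.
  rewrite (big_rem (phi w))/=; last exact: fset_set_rangeP.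
  rewrite indicE mem_set// mule1 big_seq big1 ?adde0// => y.
  rewrite mem_rem_uniq ?fset_uniq// inE => /andP[yw _].
  by rewrite indicE memNset ?mule0// => /= /eqP; rewrite eq_sym (negbTE yw).
under eq_integral do rewrite E.
rewrite ge0_integral_sum//; last 2 first.
  - move=> y; apply: measurable_funeM; apply/measurable_EFinP.
    exact: measurable_indic.
  - by move=> y w _; rewrite mule_ge0 ?lee_fin.
rewrite -sumEFin; apply: eq_bigr => y _.
rewrite ge0_integralZl_EFin//; last first.
  by apply/measurable_EFinP; exact: measurable_indic.
by rewrite integral_indic// setIC EFinM fineK ?mass// muleC.
Qed.

(** A simple function may be integrated over any finite partition on which it is constant. With phi
    the pair of two simple functions, both are summed over the same pieces, which is how they are
    compared. *)
Lemma simple_integral_comp (X : normedModType R) (h : Y -> X) :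
  simple_integral mu D (h \o phi) =
  \sum_(y <- fset_set (range phi)) fine (mu (D `&` phi @^-1` [set y])) *: h y.
Proof.
have fh := finite_range_comp fphi h.
have mh x : measurable ((h \o phi) @^-1` [set x]).
  exact: (measurable_finite_range_preimage fphi mphi (h @^-1` [set x])).
rewrite /simple_integral fsbig_finite//.
transitivity (\sum_(x <- fset_set (range (h \o phi)))
    \sum_(y <- fset_set (range phi))
    (fine (mu (D `&` phi @^-1` [set y])) * (h y == x)%:R) *: x).
  apply: eq_bigr => x _; rewrite -scaler_suml; congr (_ *: _).
  apply: EFin_inj.
  rewrite -(integral_finite_range (fun y => ler0n R (h y == x))).
  rewrite fineK ?mass// setIC -integral_indic//.
  apply: eq_integral => w _; rewrite indicE; congr (_%:R%:E).
  by congr nat_of_bool; apply/idP/eqP; rewrite inE.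
rewrite exchange_big/=; apply: eq_big_seq => y yP.
have [w _ hw] : range phi y by move: yP; rewrite in_fset_set// inE.
rewrite (big_rem (h y))/=; last first.
  by rewrite in_fset_set// inE; exists w => //=; rewrite hw.
rewrite eqxx mulr1 big_seq big1 ?addr0// => x.
rewrite mem_rem_uniq ?fset_uniq// inE => /andP[xy _].
by rewrite eq_sym (negbTE xy) mulr0 scale0r.
Qed.

End pushforward.

Context (X : normedModType R).
Implicit Types s : T -> X.

Lemma simple_pair_finite s s' : simple_function measurable s ->
  simple_function measurable s' -> finite_set (range (fun w => (s w, s' w))).
Proof.
move=> [fs _] [fs' _].
apply: (@sub_finite_set _ _ (range s `*` range s')); last exact: finite_setX.
by move=> _ [w _ <-]; split; exists w.
Qed.

Lemma simple_pair_measurable s s' y : simple_function measurable s ->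
  simple_function measurable s' ->
  measurable ((fun w => (s w, s' w)) @^-1` [set y]).
Proof.
move=> [_ ms] [_ ms'].
rewrite (_ : _ @^-1` _ = s @^-1` [set y.1] `&` s' @^-1` [set y.2]).
  exact: measurableI.
by apply/seteqP; split => w /=; [move=> <-|case: y => y1 y2 /= [-> ->]].
Qed.

Lemma simple_integral_dist s s' : simple_function measurable s ->
  simple_function measurable s' ->
  (`|simple_integral mu D s - simple_integral mu D s'|%:E <=
    \int[mu]_(w in D) `|s w - s' w|%:E)%E.
Proof.
move=> ss ss'; pose phi w := (s w, s' w).
have fphi := simple_pair_finite ss ss'.
have mphi y := simple_pair_measurable y ss ss'.
rewrite (simple_integral_comp fphi mphi fst : simple_integral mu D s = _).
rewrite (simple_integral_comp fphi mphi snd : simple_integral mu D s' = _).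
rewrite (@integral_finite_range _ phi fphi mphi (fun y => `|y.1 - y.2|))//.
rewrite lee_fin -sumrB (le_trans (ler_norm_sum _ _ _))//.
by apply: ler_sum => y _; rewrite -scalerBr normrZ ger0_norm//.
Qed.

Lemma simple_integral_cst (c : X) : simple_integral mu D (cst c) = fine (mu D) *: c.
Proof.
have ft : finite_set (range (fun _ : T => tt)) by exact: finite_finset.
have mt y : measurable ((fun _ : T => tt) @^-1` [set y]).
  by case: y; rewrite (_ : _ @^-1` _ = setT)//; apply/seteqP; split.
rewrite (simple_integral_comp ft mt (fun=> c) : simple_integral mu D (cst c) = _).
have -> : range (fun _ : T => tt) = [set tt].
  by apply/seteqP; split => [[]//|_ ->]; exists point.
rewrite fset_set1 big_seq_fset1; congr (fine (mu _) *: _).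
by apply/seteqP; split => [w []//|w Dw]; split.
Qed.

End simple_integral.

Lemma cvge0_lt (R : realType) (J : Type) (F : set_system J) {FF : Filter F}
    (u : J -> \bar R) (e : R) : u @ F --> 0%E -> 0 < e ->
  \forall n \near F, (u n < e%:E)%E.
Proof.
move=> /fine_cvgP[fu u0] e0; have H := cvgr_lt _ u0 _ e0.
near=> n.
have fn : u n \is a fin_num by near: n; exact: fu.
have un : fine (u n) < e by near: n; exact: H.
by rewrite -(fineK fn) lte_fin.
Unshelve. all: by end_near. Qed.

(** * Strong measurability and dominated simple approximations *)

Section strongly_measurable.
Context d (T : measurableType d) (R : realType) (X : normedModType R).
Implicit Types f g s : T -> X.

Lemma strongly_measurable_simple (G : set (set T)) s :
  simple_function G s -> strongly_measurable G s.
Proof. by move=> ss; exists (fun=> s); split => // w; exact: cvg_cst. Qed.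

Lemma simple_function_cst (c : X) : simple_function measurable (cst c : T -> X).
Proof.
split.
  apply: (@sub_finite_set _ _ [set c]); last exact: finite_set1.
  by move=> _ [w _ <-].
move=> x; rewrite preimage_cst; case: ifPn => _.
  exact: measurableT.
exact: measurable0.
Qed.

Lemma strongly_measurable_cst (c : X) : strongly_measurable measurable (cst c : T -> X).
Proof. exact: strongly_measurable_simple (simple_function_cst c). Qed.

Lemma measurable_norm_sub f g : strongly_measurable measurable f ->
  strongly_measurable measurable g ->
  measurable_fun setT (fun w => `|f w - g w|).
Proof.
move=> [s [ss sf]] [s' [ss' sg]].
apply: (@measurable_fun_cvg _ _ _ _ (fun n w => `|s n w - s' n w|)).
  move=> n; pose phi w := (s n w, s' n w).
  have fphi := simple_pair_finite (ss n) (ss' n).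
  have mphi y := simple_pair_measurable y (ss n) (ss' n).
  exact: (@measurable_finite_range _ _ _ phi fphi mphi _ _ (fun y => `|y.1 - y.2|)).
by move=> w _; apply: cvg_norm; apply: cvgB; [exact: sf|exact: sg].
Qed.

Lemma measurable_norm_subc f (c : X) : strongly_measurable measurable f ->
  measurable_fun setT (fun w => `|f w - c|).
Proof. by move=> mf; exact: (measurable_norm_sub mf (strongly_measurable_cst c)). Qed.

Lemma measurable_norm f : strongly_measurable measurable f ->
  measurable_fun setT (fun w => `|f w|).
Proof.
move=> mf; rewrite (_ : (fun w => _) = (fun w => `|f w - 0|)).
  exact: measurable_norm_subc.
by apply/funext => w; rewrite subr0.
Qed.

Lemma emeasurable_norm_sub f g : strongly_measurable measurable f ->
  strongly_measurable measurable g ->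
  measurable_fun setT (fun w => `|f w - g w|%:E).
Proof. by move=> mf mg; apply/measurable_EFinP; exact: measurable_norm_sub. Qed.

(** Replacing a value of norm above 2 |f w| by 0 makes the sequence dominated without spoiling
    convergence: where f w = 0 the new sequence is constantly 0, and elsewhere the original values
    are eventually below 2 |f w|. *)
Lemma simple_approximation f : strongly_measurable measurable f ->
  exists s : nat -> T -> X, [/\ forall n, simple_function measurable (s n),
    forall w, s n w @[n --> \oo] --> f w &
    forall n w, `|s n w| <= 2 * `|f w|].
Proof.
move=> mf; have [s [ss sf]] := mf.
pose A n := [set w | `|s n w| <= 2 * `|f w|].
have mA n : measurable (A n).
  rewrite -[A n]setTI; apply: measurable_fun_le => //.
    exact/measurable_norm/strongly_measurable_simple.
  by apply: measurable_funM => //; exact: measurable_norm.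
pose s' n w := if `|s n w| <= 2 * `|f w| then s n w else 0.
exists s'; split.
- move=> n; split.
    apply: (@sub_finite_set _ _ (range (s n) `|` [set 0])).
      move=> _ [w _ <-]; rewrite /s'; case: ifP => _; [left; by exists w|by right].
    by rewrite finite_setU; split; [case: (ss n)|exact: finite_set1].
  move=> x; have [_ /(_ x) ms] := ss n.
  have [->|x0] := eqVneq x 0.
    rewrite (_ : _ @^-1` _ = (A n `&` s n @^-1` [set 0]) `|` ~` A n).
      apply: measurableU; first by apply: measurableI => //; case: (ss n).
      exact: measurableC.
    apply/seteqP; split => w /=; rewrite /s'/A/=; case: ifPn => //= a.
    + by move=> ->; left.
    + by right; exact/negP.
    + by case=> [[]//|/(_ isT)].
  rewrite (_ : _ @^-1` _ = A n `&` s n @^-1` [set x]); first exact: measurableI.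
  apply/seteqP; split => w /=; rewrite /s'/A/=; case: ifPn => //= a.
  + by move=> /esym/eqP; rewrite (negbTE x0).
  + by case=> //.
  + by case=> //; rewrite (negbTE a).
- move=> w; have [fw0|fw0] := eqVneq (f w) 0.
    rewrite fw0 (_ : (fun n => s' n w) = cst 0); first exact: cvg_cst.
    apply/funext => n; rewrite /s' fw0 normr0 mulr0 normr_le0.
    by case: ifP => [/eqP|].
  have H : \forall n \near \oo, `|s n w| <= 2 * `|f w|.
    have fw2 : `|f w| < 2 * `|f w| by rewrite mulrDl mul1r ltrDl normr_gt0.
    have H := cvgr_lt _ (cvg_norm (sf w)) _ fw2.
    near=> n; apply: ltW; near: n.
    exact: H.
  apply: cvg_trans (sf w); apply: near_eq_cvg.
  by apply: filterS H => n; rewrite /s' => ->.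
- move=> n w; rewrite /s'; case: ifPn => // _.
  by rewrite normr0 mulr_ge0.
Unshelve. all: by end_near. Qed.

End strongly_measurable.

Section bochner.
Context d (T : measurableType d) (R : realType).
Variables (mu : {measure set T -> \bar R}) (D : set T).
Hypotheses (mD : measurable D) (muD : (mu D < +oo)%E).

Lemma L1_approximation (X : normedModType R) (f : T -> X) (s : nat -> T -> X) :
  strongly_measurable measurable f ->
  (forall n, simple_function measurable (s n)) ->
  (forall w, s n w @[n --> \oo] --> f w) ->
  (forall n w, `|s n w| <= 2 * `|f w|) ->
  (\int[mu]_(w in D) `|f w|%:E < +oo)%E ->
  (\int[mu]_(w in D) `|f w - s n w|%:E)%E @[n --> \oo] --> 0%E.
Proof.
move=> mf ss sf s2 foo.
have ms n := strongly_measurable_simple (ss n).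
have mfD : measurable_fun D (fun w => `|f w|%:E).
  by apply/measurable_funTS/measurable_EFinP; exact: measurable_norm.
(* The dominating function is |f| + 2 |f|, from the bound on the approximations. *)
have := @dominated_convergence _ _ _ mu D mD
  (fun n w => `|f w - s n w|%:E) (cst 0%E) (fun w => 3%:E * `|f w|%:E)%E.
rewrite integral0; case => //.
- by move=> n; apply/measurable_funTS/emeasurable_norm_sub.
- apply: aeW => w _; apply: cvg_EFin; first exact: nearW.
  rewrite -(normr0 X) -[X in `|X|](subrr (f w)).
  by apply: cvg_norm; apply: cvgB; [exact: cvg_cst|exact: sf].
- apply: integrableZl => //; apply/integrableP; split => //.
  by under eq_integral do rewrite abse_EFin normr_id.
- apply: aeW => w n _; rewrite abse_EFin normr_id -EFinM lee_fin.
  by have := s2 n w; have := ler_normB (f w) (s n w); lra.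
Qed.

(** Comparing v with the integral mu(D) c of a constant takes the place of additivity of the Bochner
    integral: it is the form in which conditional expectations are estimated on small pieces, and c
    = 0 gives the usual norm inequality. *)
Lemma norm_is_bochner_integral_sub (X : normedModType R) (f : T -> X) (v c : X) :
  is_bochner_integral mu D f v ->
  (`|v - fine (mu D) *: c|%:E <= \int[mu]_(w in D) `|f w - c|%:E)%E.
Proof.
move=> [mf [s [ss _ sf sv]]].
have ms n := strongly_measurable_simple (ss n).
have mc := @strongly_measurable_cst _ T _ _ c.
have [->|] := eqVneq (\int[mu]_(w in D) `|f w - c|%:E)%E +oo%E; first by rewrite leey.
rewrite -ltey => foo.
have f0 : (0 <= \int[mu]_(w in D) `|f w - c|%:E)%E.
  by apply: integral_ge0 => w _; rewrite lee_fin.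
have ffin : (\int[mu]_(w in D) `|f w - c|%:E)%E \is a fin_num by rewrite ge0_fin_numE.
have C1 : (`|simple_integral mu D (s n) - fine (mu D) *: c|%:E)%E @[n --> \oo] -->
    (`|v - fine (mu D) *: c|%:E)%E.
  apply: cvg_EFin; first exact: nearW.
  by apply: cvg_norm; apply: cvgB => //; exact: cvg_cst.
have C2 : (\int[mu]_(w in D) `|f w - s n w|%:E +
      \int[mu]_(w in D) `|f w - c|%:E)%E @[n --> \oo] -->
    (0 + \int[mu]_(w in D) `|f w - c|%:E)%E.
  apply: cvgeD.
  - by rewrite fin_num_adde_defl.
  - exact: sf.
  - exact: cvg_cst.
rewrite -[leRHS]add0e -(cvg_lim _ C1)// -(cvg_lim _ C2)//.
apply: lee_lim; [by apply/cvg_ex; eexists; exact: C1|by apply/cvg_ex; eexists; exact: C2|].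
apply: nearW => n.
rewrite -simple_integral_cst//.
have H := simple_integral_dist mD muD (ss n) (@simple_function_cst _ T _ _ c).
apply: (le_trans H).
rewrite -ge0_integralD//; last 2 first.
- by apply/measurable_funTS/emeasurable_norm_sub.
- by apply/measurable_funTS/(emeasurable_norm_sub mf mc).
apply: ge0_le_integral => //.
- by apply/measurable_funTS/(emeasurable_norm_sub (ms n) mc).
- apply: emeasurable_funD.
    by apply/measurable_funTS/emeasurable_norm_sub.
  by apply/measurable_funTS/(emeasurable_norm_sub mf mc).
move=> w _; rewrite -EFinD lee_fin /=.
by rewrite (distrC (f w) (s n w)) ler_distD.
Qed.

Lemma norm_is_bochner_integral (X : normedModType R) (f : T -> X) (v : X) :
  is_bochner_integral mu D f v ->
  (`|v|%:E <= \int[mu]_(w in D) `|f w|%:E)%E.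
Proof.
move=> /(norm_is_bochner_integral_sub 0); rewrite scaler0 subr0.
by under eq_integral do rewrite subr0.
Qed.

(** The default value 0 of [bochner] satisfies the bound as well. Hence it can be used at every
    point w of an ergodic average, even where the path in time fails to be integrable. *)
Lemma norm_bochner_le (X : normedModType R) (f : T -> X) (v : T -> \bar R) :
  measurable_fun D v -> (forall w, D w -> `|f w|%:E <= v w)%E ->
  (`|bochner mu D f|%:E <= \int[mu]_(w in D) v w)%E.
Proof.
move=> mv fv.
have [bf|nbf] := pselect (exists b, is_bochner_integral mu D f b); last first.
  rewrite /bochner xgetPN; last by move=> b bf; apply: nbf; exists b.
  rewrite normr0; apply: integral_ge0 => w Dw.
  by apply: le_trans (fv _ Dw).
have /= hb : is_bochner_integral mu D f (bochner mu D f).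
  by case: bf => b bf; exact: (xgetPex 0 (ex_intro _ b bf)).
apply: le_trans (norm_is_bochner_integral hb) _.
apply: ge0_le_integral => //.
by apply/measurable_funTS/measurable_EFinP/measurable_norm; case: hb.
Qed.

(** Completeness of X enters here: the integrals of an L_1-convergent sequence of simple functions
    are Cauchy because [simple_integral_dist] makes the integral 1-Lipschitz in L_1. *)
Lemma is_bochner_integral_bochner (X : completeNormedModType R) (f : T -> X) :
  strongly_measurable measurable f ->
  (\int[mu]_(w in D) `|f w|%:E < +oo)%E ->
  is_bochner_integral mu D f (bochner mu D f).
Proof.
move=> mf foo.
suff [b bf] : exists b, is_bochner_integral mu D f b.
  exact: (xgetPex 0 (ex_intro _ b bf)).
have [s [ss sf s2]] := simple_approximation mf.
have ms n := strongly_measurable_simple (ss n).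
have s0 := L1_approximation mf ss sf s2 foo.
have : cvgn (fun n => simple_integral mu D (s n)).
  apply/cauchy_cvgP/cauchy_exP => _/posnumP[e].
  have : \forall n \near \oo, (\int[mu]_(w in D) `|f w - s n w|%:E < (e%:num / 2)%:E)%E.
    exact: cvge0_lt.
  move=> [N _ HN]; exists (simple_integral mu D (s N)).
  exists N => // n /= Nn; rewrite -ball_normE/= -lte_fin.
  apply: le_lt_trans (simple_integral_dist mD muD (ss N) (ss n)) _.
  apply: (@le_lt_trans _ _ (\int[mu]_(w in D) `|f w - s N w|%:E +
      \int[mu]_(w in D) `|f w - s n w|%:E)%E); last first.
    by rewrite [e%:num]splitr EFinD lteD//; apply: HN => /=.
  rewrite -ge0_integralD//; last 2 first.
  - by apply/measurable_funTS/emeasurable_norm_sub.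
  - by apply/measurable_funTS/emeasurable_norm_sub.
  apply: ge0_le_integral => //.
  - by apply/measurable_funTS/emeasurable_norm_sub.
  - by apply: emeasurable_funD; apply/measurable_funTS/emeasurable_norm_sub.
  move=> w _; rewrite -EFinD lee_fin /=.
  by rewrite (distrC (f w) (s N w)) ler_distD.
move=> /cvg_ex[b sb]; exists b; split => //; exists s; split => //.
move=> n; apply: (@le_lt_trans _ _ (\int[mu]_(w in D) (2%:E * `|f w|%:E))%E).
  apply: ge0_le_integral => //.
  - by apply/measurable_funTS/measurable_EFinP/measurable_norm.
  - apply: measurable_funeM.
    by apply/measurable_funTS/measurable_EFinP/measurable_norm.
  - by move=> w _; rewrite -EFinM lee_fin.
rewrite ge0_integralZl_EFin//; last first.
  by apply/measurable_funTS/measurable_EFinP/measurable_norm.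
by rewrite lte_mul_pinfty.
Qed.

End bochner.

(** * Conditional expectations and Doob's inequality *)

Section sub_sigma_algebra.
Context d (T : measurableType d) (R : realType) (X : normedModType R).
Variable G : set (set T).
Hypothesis sG : Defs.sub_sigma_algebra G.

(** Taking G as the sigma-algebra of the type [g_sigma_algebraType G] lets the results on measurable
    functions be reused with G as ambient sigma-algebra. *)
Let GE : @measurable _ (g_sigma_algebraType G) = G.
Proof. by apply: measurable_g_measurableTypeE; case: sG. Qed.

Lemma strongly_measurable_sub_sigma_algebra (f : T -> X) :
  strongly_measurable G f -> strongly_measurable measurable f.
Proof.
move=> [s [ss sf]]; exists s; split => // n.
by have [fs ms] := ss n; split => // x; apply: sG.2; exact: ms.
Qed.

Lemma sub_sigma_algebra_norm_gt (f : T -> X) (l : R) :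
  strongly_measurable G f -> G [set w | l < `|f w|].
Proof.
rewrite -{1}GE => mf.
have := @measurable_norm _ (g_sigma_algebraType G) _ _ f mf.
move=> /measurable_EFinP /(emeasurable_fun_o_infty measurableT) /(_ l%:E).
by rewrite setTI GE.
Qed.

Lemma sub_sigma_algebra_simple_approximation (f : T -> X) :
  strongly_measurable G f ->
  exists s : nat -> T -> X, [/\ forall n, simple_function G (s n),
    forall w, s n w @[n --> \oo] --> f w &
    forall n w, `|s n w| <= 2 * `|f w|].
Proof.
rewrite -GE => mf.
exact: (@simple_approximation _ (g_sigma_algebraType G) _ _ f mf).
Qed.

End sub_sigma_algebra.

Lemma ge0_integral_finite_partition d (T : measurableType d) (R : realType)
    (mu : {measure set T -> \bar R}) (Y : choiceType) (phi : T -> Y)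
    (B : set T) (h : T -> \bar R) :
  measurable B -> finite_set (range phi) ->
  (forall y, measurable (phi @^-1` [set y])) ->
  measurable_fun B h -> (forall w, B w -> 0 <= h w)%E ->
  (\int[mu]_(w in B) h w =
   \sum_(y <- fset_set (range phi)) \int[mu]_(w in B `&` phi @^-1` [set y]) h w)%E.
Proof.
move=> mB fphi mphi mh h0.
pose P : seq Y := fset_set (range phi).
have BE : B = \big[setU/set0]_(y <- P) (B `&` phi @^-1` [set y]).
  rewrite -bigcup_seq; apply/seteqP; split => [w Bw|w [y _ []]//].
  by exists (phi w) => //=; exact: fset_set_rangeP.
rewrite {1}BE ge0_integral_bigsetU//.
- by move=> y; exact: measurableI.
- exact: fset_uniq.
- by apply: trivIset_setIl; apply/trivIsetP => i j _ _ ij;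
    apply/seteqP; split => // w [/= -> /eqP]; rewrite (negbTE ij).
- by rewrite -BE.
- by rewrite -BE.
Qed.

Section condexp.
Context d (T : measurableType d) (R : realType) (X : completeNormedModType R).
Variables (mu : {finite_measure set T -> \bar R}) (G : set (set T)).
Hypothesis sG : Defs.sub_sigma_algebra G.
Local Open Scope ereal_scope.

(* B is cut along the fibers of a G-simple approximation of E, and on each piece
   E is compared with a constant; this avoids norming functionals. *)
Lemma condexp_norm_le (u E : T -> X) (v : T -> \bar R) (B : set T) :
  is_condexp mu G u E -> measurable_fun setT v ->
  (forall w, `|u w|%:E <= v w) -> G B ->
  \int[mu]_(w in B) `|E w|%:E <= \int[mu]_(w in B) v w.
Proof.
move=> [mE [_ LE] EB] mv uv GB.
have v0 w : 0 <= v w by apply: le_trans (uv w); rewrite lee_fin.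
have mE' := strongly_measurable_sub_sigma_algebra sG mE.
have mB : measurable B by exact: sG.2.
have fin A : measurable A -> mu A < +oo.
  by move=> mA; rewrite -ge0_fin_numE// fin_num_measure.
have Efin A : measurable A -> \int[mu]_(w in A) `|E w|%:E < +oo.
  move=> mA; apply: (@le_lt_trans _ _ (\int[mu]_w `|E w|%:E)).
    apply: ge0_subset_integral => //; apply/measurable_EFinP.
    exact: measurable_norm.
  move: LE; rewrite /Lpnorm Lnorm1; under eq_integral do rewrite abse_EFin normr_id.
  by [].
have [s [ss sE s2]] := sub_sigma_algebra_simple_approximation sG mE.
have ssm n : simple_function measurable (s n).
  by have [fs ms] := ss n; split => // x; apply: sG.2; exact: ms.
have msm n := strongly_measurable_simple (ssm n).
have s0 := L1_approximation mB mE' ssm sE s2 (Efin _ mB).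
have mD n : measurable_fun setT (fun w => `|E w - s n w|%:E).
  exact: emeasurable_norm_sub.
have mN : measurable_fun setT (fun w => `|E w|%:E).
  by apply/measurable_EFinP; exact: measurable_norm.
(* On a fiber C of value x, the integral of |E| is at most that of |E - x| plus |x| mu(C). In turn
   |x| mu(C) is at most the norm of the integral of E over C, which is that of u, plus the integral
   of |E - x| again; hence the factor 2. *)
have key n : \int[mu]_(w in B) `|E w|%:E <=
    \int[mu]_(w in B) v w + 2%:E * \int[mu]_(w in B) `|E w - s n w|%:E.
  have [fs ms] := ss n.
  have msx x : measurable (s n @^-1` [set x]) by case: (ssm n).
  have part (h : T -> \bar R) : measurable_fun setT h -> (forall w, 0 <= h w) ->
    \int[mu]_(w in B) h w = \sum_(x <- fset_set (range (s n)))
      \int[mu]_(w in B `&` s n @^-1` [set x]) h w.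
    move=> mh h0; apply: ge0_integral_finite_partition => //.
    exact: measurable_funTS.
  rewrite (part _ mN)// (part _ mv)// (part _ (mD n))//.
  rewrite ge0_sume_distrr; last first.
    by move=> x _; apply: integral_ge0 => w _; rewrite lee_fin.
  rewrite -big_split/=; apply: lee_sum => x _.
  pose C := B `&` s n @^-1` [set x].
  have GC : G C.
    have GE : @measurable _ (g_sigma_algebraType G) = G.
      by apply: measurable_g_measurableTypeE; case: sG.
    have := @measurableI _ (g_sigma_algebraType G) B (s n @^-1` [set x]).
    by rewrite GE; apply => //; exact: ms.
  have mC : measurable C by exact: sG.2.
  have muC : mu C \is a fin_num by rewrite ge0_fin_numE//; exact: fin.
  have DC : \int[mu]_(w in C) `|E w - s n w|%:E = \int[mu]_(w in C) `|E w - x|%:E.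
    by apply: eq_integral => w; rewrite inE => -[_ /= ->].
  have D0 : 0 <= \int[mu]_(w in C) `|E w - x|%:E.
    by apply: integral_ge0 => w _; rewrite lee_fin.
  have mDx : measurable_fun C (fun w => `|E w - x|%:E).
    apply/measurable_funTS/measurable_EFinP; exact: measurable_norm_subc.
  have bE := is_bochner_integral_bochner mC (fin _ mC) mE' (Efin _ mC).
  have H1 := norm_is_bochner_integral_sub mC (fin _ mC) x bE.
  have H2 : `|bochner mu C E|%:E <= \int[mu]_(w in C) v w.
    rewrite (EB _ GC); apply: (norm_bochner_le mC (fin _ mC)) => //.
    exact: measurable_funTS.
  have H3 : \int[mu]_(w in C) `|E w|%:E <=
      \int[mu]_(w in C) `|E w - x|%:E + `|x|%:E * mu C.
    rewrite -integral_cst// -ge0_integralD//; last by move=> w _; rewrite lee_fin.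
    apply: ge0_le_integral => //.
    - exact: measurable_funTS.
    - exact: emeasurable_funD.
    - by move=> w _; rewrite -EFinD lee_fin /= -{1}(subrK x (E w)) ler_normD.
  have H4 : `|x|%:E * mu C <= \int[mu]_(w in C) v w + \int[mu]_(w in C) `|E w - x|%:E.
    apply: le_trans (leeD H2 H1).
    rewrite -(fineK muC) -EFinM -EFinD lee_fin.
    have -> : (`|x| * fine (mu C) = `|fine (mu C) *: x|)%R.
      by rewrite normrZ mulrC ger0_norm// fine_ge0.
    by rewrite distrC addrC -lerBlDr lerB_dist.
  rewrite -/C DC; apply: le_trans H3 _.
  apply: le_trans (leeD2l _ H4) _.
  rewrite addeCA -[2%R]/(1 + 1)%R EFinD ge0_muleDl ?lee_fin// !mul1e.
  exact: lexx.
have C2 : (\int[mu]_(w in B) v w + 2%:E * \int[mu]_(w in B) `|E w - s n w|%:E)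
   @[n --> \oo] --> \int[mu]_(w in B) v w + 2%:E * 0.
  apply: cvgeD.
  - by rewrite mule0 fin_num_adde_defl.
  - exact: cvg_cst.
  - by apply: cvgeZl.
rewrite mule0 adde0 in C2.
rewrite -(cvg_lim _ C2)//; apply: lime_ge; first by apply/cvg_ex; eexists; exact: C2.
exact: nearW.
Qed.

End condexp.

Section doob.
Context d (T : measurableType d) (R : realType) (X : completeNormedModType R).
Variables (mu : {finite_measure set T -> \bar R}).
Variables (F : R -> set (set T)) (Finf : set (set T)).
Hypothesis dF : decreasing_family F Finf.
Local Open Scope ereal_scope.
Variables (u : R -> T -> X) (E : R * R -> T -> X) (v : T -> \bar R).
Hypothesis mv : measurable_fun setT v.
Hypothesis v0 : forall w, 0 <= v w.

Let level (l : R) (r : seq (R * R)) : set T :=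
  [set w | exists2 ts, ts \in r & (l < `|E ts w|)%R].

Let level_cons l ts r : level l (ts :: r) = level l r `|` [set w | (l < `|E ts w|)%R].
Proof.
apply/seteqP; split => w.
- by case=> ts'; rewrite inE => /orP[/eqP ->|r'] lE; [right|left; exists ts'].
- by case=> [[ts' r' lE]|lE]; [exists ts' => //; rewrite inE r' orbT|exists ts => //; rewrite mem_head].
Qed.

(* The sigma-algebras decrease with s, so a list sorted by increasing s is
   peeled off from the head: the level set of the tail is F s-measurable. *)
Lemma doob_weak_sorted (l : R) (r : seq (R * R)) : (0 < l)%R ->
  sorted (fun a b : R * R => a.2 <= b.2)%R r ->
  (forall ts, ts \in r -> [/\ (0 <= ts.2)%R, is_condexp mu (F ts.2) (u ts.1) (E ts) &
    forall w, `|u ts.1 w|%:E <= v w]) ->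
  measurable (level l r) /\ l%:E * mu (level l r) <= \int[mu]_(w in level l r) v w.
Proof.
move=> l0; elim: r => [|ts r IH] sr Hr.
  have -> : level l [::] = set0 by apply/seteqP; split => // w [].
  by rewrite measure0 mule0 integral_set0.
have [mr IHr] : measurable (level l r) /\
    l%:E * mu (level l r) <= \int[mu]_(w in level l r) v w.
  apply: IH; first exact: path_sorted sr.
  by move=> ts' r'; apply: Hr; rewrite inE r' orbT.
have [s0 cE uv] := Hr ts (mem_head _ _).
have [sF dFs _] := dF.
have sG := sF _ s0.
have GE : @measurable _ (g_sigma_algebraType (F ts.2)) = F ts.2.
  by apply: measurable_g_measurableTypeE; case: sG.
have Gts ts' : ts' \in r -> F ts.2 [set w | (l < `|E ts' w|)%R].
  move=> r'; have [s0' [mE _ _] _] : [/\ (0 <= ts'.2)%R,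
      is_condexp mu (F ts'.2) (u ts'.1) (E ts') & forall w, `|u ts'.1 w|%:E <= v w].
    by apply: Hr; rewrite inE r' orbT.
  have : (ts.2 <= ts'.2)%R.
    have /allP : all (fun b => ts.2 <= b.2)%R r.
      by apply: order_path_min sr => a b c; exact: le_trans.
    exact.
  have GT := sub_sigma_algebra_norm_gt (sF _ s0') l mE.
  (* [decreasing_family] compares distinct parameters only; pairs with equal s share their
     sigma-algebra. *)
  rewrite le_eqVlt => /predU1P[->//|lts].
  exact: dFs lts _ GT.
have Gr : F ts.2 (level l r).
  rewrite (_ : level l r = \bigcup_(ts' in [set` r]) [set w | (l < `|E ts' w|)%R]).
    have := @fin_bigcup_measurable _ (g_sigma_algebraType (F ts.2)) _ [set` r]
      (fun ts' => [set w | (l < `|E ts' w|)%R]) (finite_seq r).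
    by rewrite GE; apply => ts' /Gts.
  by apply/seteqP; split => w [ts' r' lE]; exists ts'.
(* Outside the level set of the tail, [H] holds the points where [ts] is the first to exceed l when
   s decreases. On this set |E ts| > l while its integral is at most that of v. *)
pose H := [set w | (l < `|E ts w|)%R].
have [mE _ _] := cE.
have GH : F ts.2 (H `\` level l r).
  have := @measurableD _ (g_sigma_algebraType (F ts.2)) H (level l r).
  rewrite GE; apply => //; exact: (sub_sigma_algebra_norm_gt sG).
have mH : measurable (H `\` level l r) by exact: sG.2.
have -> : level l (ts :: r) = level l r `|` (H `\` level l r).
  by rewrite level_cons setDE setUIr setUv setIT.
have dis : [disjoint level l r & H `\` level l r].
  by rewrite disj_set2E setDE setICA setICr setI0.
split; first exact: measurableU.
rewrite measureU//; last by rewrite setDE setICA setICr setI0.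
rewrite ge0_integral_setU//; last exact: measurable_funTS.
rewrite muleDr ?ge0_adde_def ?inE// leeD//.
apply: le_trans (condexp_norm_le sG cE mv uv GH).
rewrite -integral_cst//; apply: ge0_le_integral => //.
- by move=> w _; rewrite lee_fin ltW.
- apply/measurable_funTS/measurable_EFinP/measurable_norm.
  exact: strongly_measurable_sub_sigma_algebra mE.
- by move=> w [/= lE _]; rewrite lee_fin ltW.
Qed.

(** The order of the sequence is immaterial: its first n pairs are sorted by s whatever their t,
    since the same v dominates all of them. A strict inequality l < sup is attained by some term, so
    the level set of the supremum is the increasing union of those of the finite families. *)
Lemma doob_weak (i : nat -> R * R) (l : R) : (0 < l)%R ->
  (forall n, [/\ (0 <= (i n).2)%R, is_condexp mu (F (i n).2) (u (i n).1) (E (i n)) &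
    forall w, `|u (i n).1 w|%:E <= v w]) ->
  l%:E * mu [set w | l%:E < ereal_sup (range (fun n => `|E (i n) w|%:E))] <=
    \int[mu]_(w in [set w | l%:E < ereal_sup (range (fun n => `|E (i n) w|%:E))]) v w.
Proof.
move=> l0 Hi.
pose S w := ereal_sup (range (fun n => `|E (i n) w|%:E)).
rewrite -/(S _).
pose A n := level l (sort (fun a b : R * R => a.2 <= b.2)%R [seq i k | k <- iota 0 n]).
have AE n w : A n w <-> exists2 k, (k < n)%N & (l < `|E (i k) w|)%R.
  split.
    move=> [ts]; rewrite mem_sort => /mapP[k].
    by rewrite mem_iota/= => kn -> lE; exists k.
  move=> [k kn lE]; exists (i k) => //; rewrite mem_sort; apply/mapP; exists k => //.
  by rewrite mem_iota.
have HA n : measurable (A n) /\ l%:E * mu (A n) <= \int[mu]_(w in A n) v w.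
  apply: doob_weak_sorted => //.
    by apply: sort_sorted => a b; exact: le_total.
  by move=> ts; rewrite mem_sort => /mapP[k _ ->].
have SE : [set w | l%:E < S w] = \bigcup_n A n.
  apply/seteqP; split => w /=.
    move=> /ereal_sup_gt[_ [k _ <-]]; rewrite lte_fin => lE.
    by exists k.+1 => //; apply/AE; exists k.
  move=> [n _ /AE[k kn lE]]; apply: (@lt_le_trans _ _ (`|E (i k) w|%:E)).
    by rewrite lte_fin.
  by apply: ereal_sup_ubound; exists k.
rewrite -/[set w | l%:E < S w] SE.
have ndA : nondecreasing_seq A.
  move=> m n mn; apply/subsetPset => w /AE[k km lE]; apply/AE; exists k => //.
  exact: leq_trans mn.
have mA n : measurable (A n) by case: (HA n).
have mUA : measurable (\bigcup_n A n) by exact: bigcupT_measurable.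
have cA : l%:E * mu (A n) @[n --> \oo] --> l%:E * mu (\bigcup_n A n).
  by apply: cvgeZl => //; exact: nondecreasing_cvg_mu.
rewrite -(cvg_lim _ cA)//; apply: lime_le; first by apply/cvg_ex; eexists; exact: cA.
apply: nearW => n; have [_ /le_trans] := HA n; apply.
apply: ge0_subset_integral => //; first exact: measurable_funTS.
exact: bigcup_sup.
Qed.

End doob.

(** * The maximal ergodic inequality for a positive contraction *)

Section real_L1.
Context d (T : measurableType d) (R : realType).
Variable mu : {measure set T -> \bar R}.
Implicit Types f : T -> R^o.

Lemma strongly_measurable_measurable f : strongly_measurable measurable f ->
  measurable_fun setT (f : T -> R).
Proof.
move=> [s [ss sf]]; apply: (@measurable_fun_cvg _ _ _ _ s); last first.
  by move=> w _; exact: sf.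
move=> n; have [fs ms] := ss n.
exact: (@measurable_finite_range _ _ _ (s n) fs ms _ _ (fun y : R^o => (y : R))).
Qed.

Import HBSimple.

Lemma measurable_strongly_measurable f : measurable_fun setT (f : T -> R) ->
  strongly_measurable measurable f.
Proof.
move=> mf.
have mf' : measurable_fun setT (EFin \o (f : T -> R)) by exact/measurable_EFinP.
have [g gf] := approximation_sfun measurableT mf'.
exists (fun n => (g n : T -> R) : T -> R^o); split => [n|w].
  split; first exact: fimfunP.
  by move=> x; rewrite -[X in measurable X]setTI; exact: measurable_funP.
have := gf w I => /fine_cvgP[_]; exact.
Qed.

Lemma in_L1P f : in_Lp mu 1%E f <->
  measurable_fun setT (f : T -> R) /\ (\int[mu]_w `|f w|%:E < +oo)%E.
Proof.
have NE : Lpnorm mu 1%E f = (\int[mu]_w `|f w|%:E)%E.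
  by rewrite /Lpnorm Lnorm1; apply: eq_integral => w _; rewrite abse_EFin normr_id.
split => -[mf].
  by rewrite NE => foo; split => //; exact: strongly_measurable_measurable.
by move=> foo; split; [exact: measurable_strongly_measurable|rewrite NE].
Qed.

Lemma in_L1_integrable f : in_Lp mu 1%E f <-> mu.-integrable setT (EFin \o (f : T -> R)).
Proof.
rewrite in_L1P; split.
  by move=> [mf foo]; apply/integrableP; split => //; exact/measurable_EFinP.
by move=> /integrableP[/measurable_EFinP mf foo].
Qed.

Lemma in_L1D f g : in_Lp mu 1%E f -> in_Lp mu 1%E g ->
  in_Lp mu 1%E (fun w => f w + g w).
Proof.
move=> /in_L1_integrable If /in_L1_integrable Ig; apply/in_L1_integrable.
rewrite (_ : EFin \o _ = (EFin \o (f : T -> R)) \+ (EFin \o (g : T -> R)))%E.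
  exact: integrableD.
by apply/funext => w /=; rewrite EFinD.
Qed.

Lemma in_L1Z (a : R) f : in_Lp mu 1%E f -> in_Lp mu 1%E (fun w => a *: f w).
Proof.
move=> /in_L1_integrable If; apply/in_L1_integrable.
rewrite (_ : EFin \o _ = (fun w => a%:E * (EFin \o (f : T -> R)) w))%E.
  exact: integrableZl.
by apply/funext => w /=; rewrite EFinM.
Qed.

Lemma in_L1B f g : in_Lp mu 1%E f -> in_Lp mu 1%E g ->
  in_Lp mu 1%E (fun w => f w - g w).
Proof.
move=> Lf Lg; rewrite (_ : (fun w => _) = (fun w => f w + (-1) *: g w)).
  exact/in_L1D/in_L1Z.
by apply/funext => w; rewrite scaleN1r.
Qed.

Lemma in_L1_max f g : in_Lp mu 1%E f -> in_Lp mu 1%E g ->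
  in_Lp mu 1%E (fun w => Num.max (f w : R) (g w) : R^o).
Proof.
move=> /in_L1P[mf If] /in_L1P[mg Ig]; apply/in_L1P; split.
  exact: measurable_maxr.
apply: (@le_lt_trans _ _ (\int[mu]_w `|f w|%:E + \int[mu]_w `|g w|%:E)%E).
  rewrite -ge0_integralD//; last 2 first.
  - exact/measurable_EFinP/measurableT_comp.
  - exact/measurable_EFinP/measurableT_comp.
  apply: ge0_le_integral => //.
  - apply/measurable_EFinP/measurableT_comp => //; exact: measurable_maxr.
  - by apply: emeasurable_funD; apply/measurable_EFinP/measurableT_comp.
  - move=> w _; rewrite -EFinD lee_fin.
    by case: (leP (f w : R) (g w)) => _; rewrite ?lerDl ?lerDr.
exact: lte_add_pinfty.
Qed.

End real_L1.

Lemma in_L1_cst d (T : measurableType d) (R : realType)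
    (mu : {finite_measure set T -> \bar R}) (c : R) :
  in_Lp mu 1%E (cst c : T -> R^o).
Proof.
apply/in_L1_integrable.
exact: (@finite_measure_integrable_cst _ _ _ mu setT c measurableT).
Qed.

(** The maximum runs over indices strictly below n, with x0 as a floor. It is stated for any total
    order because it serves both the real discrete averages and the extended-real averages in
    continuous time. *)
Fixpoint running_max disp (T : orderType disp) (x0 : T) (a : nat -> T) (n : nat) : T :=
  if n is n'.+1 then Order.max (running_max x0 a n') (a n') else x0.

Section running_max.
Context disp (T : orderType disp).
Variable x0 : T.
Implicit Types (a : nat -> T).
Local Open Scope order_scope.

Lemma running_max_ge_init a n : x0 <= running_max x0 a n.
Proof. by elim: n => //= n IH; rewrite le_max IH. Qed.

Lemma running_max_ge a n k : (k < n)%N -> a k <= running_max x0 a n.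
Proof.
elim: n => //= n IH; rewrite ltnS leq_eqVlt => /predU1P[->|/IH kn].
  by rewrite le_max lexx orbT.
by rewrite le_max kn.
Qed.

Lemma running_max_le a n c : x0 <= c -> (forall k, (k < n)%N -> a k <= c) ->
  running_max x0 a n <= c.
Proof.
move=> x0c; elim: n => //= n IH ac; rewrite ge_max IH ?ac// => k kn.
by apply: ac; rewrite ltnS ltnW.
Qed.

Lemma running_max_gt_init a n : x0 < running_max x0 a n ->
  exists2 k, (k < n)%N & running_max x0 a n = a k.
Proof.
elim: n => [|n IH]; first by rewrite ltxx.
rewrite /=; case: (leP (running_max x0 a n) (a n)) => _; first by exists n.
by move=> /IH[k kn ->]; exists k => //; rewrite ltnS ltnW.
Qed.

End running_max.

Section measurable_running_max.
Context (R : realType) d (T : measurableType d).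

Lemma measurable_running_max (a : nat -> T -> R) n :
  (forall k, measurable_fun setT (a k)) ->
  measurable_fun setT (fun w => running_max 0 (a ^~ w) n).
Proof.
move=> ma; elim: n => [|n IH]; first exact: measurable_cst.
exact: measurable_maxr.
Qed.

Lemma emeasurable_running_max (a : nat -> T -> \bar R) n :
  (forall k, measurable_fun setT (a k)) ->
  measurable_fun setT (fun w => running_max 0%E (a ^~ w) n).
Proof.
move=> ma; elim: n => [|n IH]; first exact: measurable_cst.
exact: measurable_maxe.
Qed.

End measurable_running_max.

Section positive_contraction.
Context d (T : measurableType d) (R : realType).
Variable mu : {finite_measure set T -> \bar R}.
Variable Q : (T -> R^o) -> (T -> R^o).
Hypothesis QL : L1_operator mu Q.
Hypothesis Qc : L1_Loo_contraction mu Q.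
Hypothesis Qpos : forall h, in_Lp mu 1%E h -> (forall w, 0 <= (h w : R)) ->
  {ae mu, forall w, 0 <= (Q h w : R)}.
Implicit Types f g h : T -> R^o.

Lemma L1_operatorD f g : in_Lp mu 1%E f -> in_Lp mu 1%E g ->
  {ae mu, forall w, Q (fun x => f x + g x) w = Q f w + Q g w}.
Proof.
move=> Lf Lg; have [_ _ /(_ 1 f g Lf Lg)] := QL.
rewrite (_ : (fun x => 1 *: f x + g x) = (fun x => f x + g x)); last first.
  by apply/funext => x; rewrite scale1r.
by apply: filterS => w ->; rewrite scale1r.
Qed.

Lemma L1_operatorB f g : in_Lp mu 1%E f -> in_Lp mu 1%E g ->
  {ae mu, forall w, Q (fun x => f x - g x) w = Q f w - Q g w}.
Proof.
move=> Lf Lg; have [_ _ /(_ (-1) g f Lg Lf)] := QL.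
rewrite (_ : (fun x => -1 *: g x + f x) = (fun x => f x - g x)); last first.
  by apply/funext => x; rewrite scaleN1r addrC.
by apply: filterS => w ->; rewrite scaleN1r addrC.
Qed.

Lemma L1_operator0 : {ae mu, forall w, Q (cst 0) w = 0}.
Proof.
have L0 := in_L1_cst mu 0.
have := L1_operatorD L0 L0.
rewrite (_ : (fun x => cst 0 x + cst 0 x : R^o) = cst 0); last first.
  by apply/funext => x; rewrite /= addr0.
by apply: filterS => w /eqP; rewrite -subr_eq subrr => /eqP.
Qed.

Lemma positive_L1_operator_le f g : in_Lp mu 1%E f -> in_Lp mu 1%E g ->
  (forall w, (f w : R) <= g w) -> {ae mu, forall w, (Q f w : R) <= Q g w}.
Proof.
move=> Lf Lg fg; have H1 := L1_operatorB Lg Lf.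
have := Qpos (in_L1B Lg Lf) (fun w => etrans (subr_ge0 _ _) (fg w)).
by apply: filterS2 H1 => w ->; rewrite subr_ge0.
Qed.

Lemma L1_Loo_contraction_cst (c : R) : 0 <= c ->
  {ae mu, forall w, (Q (cst c) w : R) <= c}.
Proof.
(* [Lnorm] at +oo is the essential supremum only when the total mass is positive. *)
move=> c0; have [m0|m0] := eqVneq (mu setT) 0%E.
  exact: measure0_ae.
have mu0 : (0 < mu setT)%E by rewrite lt0e m0 measure_ge0.
have [_] := Qc (in_L1_cst mu c).
rewrite /Lpnorm unlock mu0 => H.
have Hc : (ess_sup mu (abse \o (fun w => `|cst c w : R|%:E)) <= c%:E)%E.
  apply/ess_supP; apply: aeW => w /=.
  by rewrite normr_id ger0_norm.
have /ess_supP := le_trans H Hc.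
apply: filterS => w /=; rewrite lee_fin normr_id.
by apply: le_trans; exact: ler_norm.
Qed.

Lemma L1_contraction_integral f : in_Lp mu 1%E f ->
  (\int[mu]_w `|Q f w : R|%:E <= \int[mu]_w `|f w : R|%:E)%E.
Proof.
move=> /Qc [+ _]; rewrite /Lpnorm !Lnorm1.
under eq_integral do rewrite abse_EFin normr_id.
by under [in X in (_ <= X)%E -> _]eq_integral do rewrite abse_EFin normr_id.
Qed.

(** The orbit is a sequence with an almost-everywhere recursion rather than iterates of Q: it will
    be instantiated by |P_{k/(N+1)} h|, which follows the powers of P_{1/(N+1)} only up to null
    sets. *)
Variable u : nat -> T -> R^o.
Hypothesis Lu : forall k, in_Lp mu 1%E (u k).
Hypothesis u0 : forall k w, 0 <= (u k w : R).
Hypothesis uS : forall k, {ae mu, forall w, u k.+1 w = Q (u k) w}.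

Section hopf.
Variable l : R.
Hypothesis l0 : 0 < l.

Let D k w : R^o := \sum_(j < k) u j w - k%:R * l.

Let LD k : in_Lp mu 1%E (D k).
Proof.
apply: in_L1B; last exact: in_L1_cst.
elim: k => [|k IH].
  rewrite (_ : (fun _ => _) = cst 0); first exact: in_L1_cst.
  by apply/funext => w; rewrite big_ord0.
rewrite (_ : (fun _ => _) = (fun w => \sum_(j < k) u j w + u k w)).
  exact: in_L1D.
by apply/funext => w; rewrite big_ord_recr.
Qed.

Let D0 w : D 0 w = 0.
Proof. by rewrite /D big_ord0 mul0r subr0. Qed.

Let DS k w : D k.+1 w = D k w + (u k w - l).
Proof. by rewrite /D big_ord_recr/= -natr1; ring. Qed.

(** For the orbit of u 0 - l itself this would be an equality. Here l is subtracted as a constant at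
    each step, and Q l <= l, from the L_oo contraction, leaves an inequality in the useful
    direction. *)
Let hopf_step k : {ae mu, forall w, (D k.+1 w : R) <= u 0 w - l + Q (D k) w}.
Proof.
elim: k => [|k IH].
  have D0E : D 0 = cst 0 by apply/funext => w; rewrite D0.
  have := L1_operator0; rewrite -D0E; apply: filterS => w Q0.
  by rewrite DS Q0 D0 add0r addr0.
have Lc := in_L1_cst mu l.
have H1 := L1_operatorD (LD k) (in_L1B (Lu k) Lc).
have H2 := L1_operatorB (Lu k) Lc.
have H3 := L1_Loo_contraction_cst (ltW l0).
have H4 := uS k.
have DE : D k.+1 = (fun x => D k x + (u k x - cst l x)).
  by apply/funext => w; rewrite DS.
near=> w.
have E1 : Q (D k.+1) w = Q (D k) w + Q (fun x => u k x - cst l x) w.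
  by rewrite DE; near: w; exact: H1.
have E2 : Q (fun x => u k x - cst l x) w = Q (u k) w - Q (cst l) w.
  by near: w; exact: H2.
have E3 : (Q (cst l) w : R) <= l by near: w; exact: H3.
have E4 : u k.+1 w = Q (u k) w by near: w; exact: H4.
have E5 : (D k.+1 w : R) <= u 0 w - l + Q (D k) w by near: w; exact: IH.
rewrite DS E1 E2 -E4.
move: E3 E5; lra.
Unshelve. all: by end_near. Qed.

Let Dmax n w : R^o := running_max (0:R) (fun k => D k.+1 w : R) n.

Let LDmax n : in_Lp mu 1%E (Dmax n).
Proof.
elim: n => [|n IH]; first exact: in_L1_cst.
exact: (in_L1_max IH (LD n.+1)).
Qed.

Let Dmax_ge0 n w : 0 <= (Dmax n w : R).
Proof. exact: running_max_ge_init. Qed.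

Let Dmax_ge n k w : (k <= n)%N -> (D k w : R) <= Dmax n w.
Proof.
case: k => [_|k kn]; first by rewrite D0; exact: Dmax_ge0.
exact: (running_max_ge (0:R) (fun k => D k.+1 w : R)).
Qed.

Let Dmax_gt0 n w : 0 < (Dmax n w : R) ->
  exists2 k, (k < n)%N & Dmax n w = D k.+1 w.
Proof. exact: running_max_gt_init. Qed.

(* Garsia's proof of Hopf's maximal ergodic lemma: Dmax <= u 0 - l + Q Dmax
   on [set Dmax > 0], and Q does not increase the integral of Dmax. *)
Lemma hopf_maximal n :
  let A := [set w : T | exists2 k, (k < n)%N &
    k.+1%:R * l < \sum_(j < k.+1) (u j w : R)] in
  (l%:E * mu A <= \int[mu]_(w in A) (u 0 w : R)%:E)%E.
Proof.
rewrite /=; set A0 := [set w : T | exists2 k, _ & _].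
have AE : A0 = [set w | 0 < (Dmax n w : R)].
  apply/seteqP; split => w /=.
    move=> [k kn H]; apply: (@lt_le_trans _ _ (D k.+1 w)); last exact: Dmax_ge.
    by rewrite /D subr_gt0.
  by move=> /[dup] H /Dmax_gt0[k kn E]; exists k => //; rewrite -subr_gt0 -/(D k.+1 w) -E.
rewrite AE; set A := [set w | _].
have [mM IM] := (in_L1P mu (Dmax n)).1 (LDmax n).
have [mu0 _] := (in_L1P mu (u 0)).1 (Lu 0).
have [QL1 _ _] := QL.
have [mQ _] := (in_L1P mu (Q (Dmax n))).1 (QL1 _ (LDmax n)).
have mA : measurable A.
  by rewrite -[A]setTI; apply: measurable_fun_ltr.
have mMA : measurable_fun A (fun w => (Dmax n w)%:E).
  by apply/measurable_funTS/measurable_EFinP.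
have muA : measurable_fun A (fun w => (u 0 w)%:E).
  by apply/measurable_funTS/measurable_EFinP.
have mQA : measurable_fun A (fun w => `|Q (Dmax n) w : R|%:E).
  by apply/measurable_funTS/measurable_EFinP; exact: measurableT_comp.
(* A positive [Dmax n w] equals some [D k.+1 w] with k < n, and [D k] lies below [Dmax n] also for k
   = 0, thanks to the floor 0; positivity passes this comparison through Q. *)
have H : {ae mu, forall w, A w ->
    ((Dmax n w)%:E + l%:E <= (u 0 w)%:E + `|Q (Dmax n) w : R|%:E)%E}.
  have H1 : {ae mu, forall w k, (D k.+1 w : R) <= u 0 w - l + Q (D k) w}.
    by apply: ae_foralln => k; exact: hopf_step.
  have H2 : {ae mu, forall w k, (k <= n)%N -> (Q (D k) w : R) <= Q (Dmax n) w}.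
    apply: ae_foralln => k; have [kn|nk] := leqP k n; last first.
      by apply: aeW => w; rewrite ?leqNgt ?nk.
    have := positive_L1_operator_le (LD k) (LDmax n) (fun w => Dmax_ge w kn).
    by apply: filterS => w.
  apply: filterS2 H1 H2 => w H1 H2 /Dmax_gt0[k kn E].
  rewrite -!EFinD lee_fin E.
  have := H1 k; have := H2 k (ltnW kn); have := ler_norm (Q (Dmax n) w : R).
  lra.
have IA : (\int[mu]_(w in A) (Dmax n w)%:E = \int[mu]_w `|Dmax n w : R|%:E)%E.
  rewrite integral_mkcond; apply: eq_integral => w _.
  rewrite patchE ger0_norm ?Dmax_ge0//; case: ifPn => //; rewrite notin_setE /A/= => /negP.
  by rewrite -leNgt => M0; congr EFin; apply/eqP; rewrite eq_le M0 Dmax_ge0.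
have IAfin : (\int[mu]_(w in A) (Dmax n w)%:E \is a fin_num)%E.
  by rewrite IA ge0_fin_numE//; apply: integral_ge0 => w _; rewrite lee_fin.
(* Adding the finite integral of [Dmax n] to both sides, instead of subtracting, keeps every
   integrand nonnegative; the absolute value around [Q (Dmax n)] has the same purpose. *)
rewrite -(leeD2lE _ _ IAfin) -integral_cst// -ge0_integralD//; last 2 first.
- by move=> w _; rewrite lee_fin Dmax_ge0.
- by move=> w _; rewrite lee_fin ltW.
apply: (@le_trans _ _ (\int[mu]_(w in A) ((u 0 w)%:E + `|Q (Dmax n) w : R|%:E))%E).
  apply: ae_ge0_le_integral => //.
  - by move=> w _; rewrite /= -EFinD lee_fin addr_ge0 ?Dmax_ge0// ltW.
  - exact: emeasurable_funD.
  - by move=> w _; rewrite -EFinD lee_fin addr_ge0.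
  - exact: emeasurable_funD.
rewrite ge0_integralD//; last by move=> w _; rewrite lee_fin.
rewrite addeC leeD2r// IA; apply: le_trans (L1_contraction_integral (LDmax n)).
apply: ge0_subset_integral => //.
by apply/measurable_EFinP; exact: measurableT_comp.
Qed.

End hopf.

(** Hopf's lemma is the weak-type hypothesis of [maximal_Lnorm]: an average exceeds l exactly when
    the sum exceeds (k+1) l, and the floor 0 is invisible at positive levels. *)
Lemma dominated_ergodic n (p : R) : 1 < p ->
  ('N[mu]_p%:E[(fun w => (running_max (0:R)
     (fun k => (\sum_(j < k.+1) (u j w : R)) / k.+1%:R) n)%:E)] <=
   (p / (p - 1))%:E * 'N[mu]_p%:E[(fun w => (u 0 w : R)%:E)])%E.
Proof.
move=> p1; have mu_ k : measurable_fun setT (u k : T -> R).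
  by have [] := (in_L1P mu (u k)).1 (Lu k).
apply: maximal_Lnorm => //.
- apply/measurable_EFinP.
  apply: (@measurable_running_max _ _ _ (fun k w => (\sum_(j < k.+1) (u j w : R)) / k.+1%:R)).
  by move=> k; apply: measurable_funM => //; exact: measurable_sum.
- exact/measurable_EFinP.
- by move=> w; rewrite lee_fin running_max_ge_init.
- by move=> w; rewrite lee_fin; exact: u0.
- move=> l l0; have := hopf_maximal l0 n.
  rewrite /=; set A := [set w : T | _]; set B := [set w : T | _].
  suff -> : A = B; first exact.
  rewrite /A /B; apply/seteqP; split => w /=; rewrite lte_fin.
    move=> [k kn H].
    have := running_max_ge (0:R) (fun k => (\sum_(j < k.+1) (u j w : R)) / k.+1%:R) kn.
    by apply: lt_le_trans; rewrite /= ltr_pdivlMr// mulrC.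
  move=> H; have [k kn E] := running_max_gt_init (lt_trans l0 H).
  by exists k => //; rewrite E ltr_pdivlMr// mulrC in H.
Qed.

End positive_contraction.

(** * Averages in continuous time *)

Section grid_step.
Context (R : realType).
Local Notation tau_type := (measurableTypeR R).
Implicit Types (N k m : nat) (tau : R).

Definition grid_index N tau : nat := Num.truncn (N.+1%:R * tau).

Lemma measurable_grid_index N k :
  measurable ([set tau | grid_index N tau = k] : set tau_type).
Proof.
have mgt n : measurable ([set tau | (n < grid_index N tau)%N] : set tau_type).
  rewrite (_ : [set _ | _] = [set tau : tau_type | n.+1%:R <= N.+1%:R * tau]).
    rewrite -[X in measurable X]setTI; exact: measurable_fun_le.
  by apply/seteqP; split => tau; rewrite /= /grid_index truncn_gt_nat.
case: k => [|k].
  rewrite (_ : [set _ | _] = ~` [set tau : tau_type | (0 < grid_index N tau)%N]).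
    exact: measurableC.
  by apply/seteqP; split => tau /=; [move=> ->|case: (grid_index N tau) => // n /(_ isT)].
rewrite (_ : [set _ | _] = [set tau : tau_type | (k < grid_index N tau)%N] `\`
    [set tau : tau_type | (k.+1 < grid_index N tau)%N]).
  exact: measurableD.
apply/seteqP; split => tau /=; first by move=> ->; rewrite ltnSn ltnn; split.
by move=> [kg /negP]; rewrite -leqNgt => gk; apply/eqP; rewrite eqn_leq gk kg.
Qed.

Lemma measurable_grid_step d (T : measurableType d) N (u : nat -> T -> R) :
  (forall k, measurable_fun setT (u k)) ->
  measurable_fun setT (fun z : tau_type * T => u (grid_index N z.1) z.2).
Proof.
move=> mu_ _ A mA; rewrite setTI.
rewrite (_ : _ @^-1` A = \bigcup_k
    ([set tau : tau_type | grid_index N tau = k] `*` (u k @^-1` A))).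
  apply: bigcupT_measurable => k; apply: measurableX.
    exact: measurable_grid_index.
  by rewrite -[X in measurable X]setTI; exact: mu_.
apply/seteqP; split => [[tau w] /= Aw|[tau w] [k _ [/= -> ]]//].
by exists (grid_index N tau).
Qed.

Lemma grid_index_itv N k tau : k%:R / N.+1%:R <= tau -> tau < k.+1%:R / N.+1%:R ->
  grid_index N tau = k.
Proof.
rewrite ler_pdivrMr// ltr_pdivlMr// => H1 H2.
by apply: truncn_def; rewrite mulrC H1 H2.
Qed.

Lemma integral_grid_step N (a : nat -> R) m : (forall k, 0 <= a k) ->
  (\int[lebesgue_measure]_(tau in (`[0%R, (m%:R / N.+1%:R)%R[%classic : set tau_type))
     (a (grid_index N tau))%:E =
   ((\sum_(k < m) a k) / N.+1%:R)%R%:E)%E.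
Proof.
move=> a0.
have ma : measurable_fun setT (fun tau : tau_type => (a (grid_index N tau))%:E).
  apply/measurable_EFinP => _ A mA; rewrite setTI.
  rewrite (_ : _ @^-1` A = \bigcup_(k in a @^-1` A)
      [set tau : tau_type | grid_index N tau = k]).
    by apply: bigcup_measurable => k _; exact: measurable_grid_index.
  apply/seteqP; split => [tau /= At|tau [k /= Ak /= ->]//].
  by exists (grid_index N tau).
elim: m => [|m IH].
  by rewrite mul0r set_itvco0 integral_set0 big_ord0 mul0r.
have mN : m%:R / N.+1%:R <= m.+1%:R / N.+1%:R :> R.
  by rewrite ler_pM2r ?invr_gt0// ler_nat.
have E : (`[0, m.+1%:R / N.+1%:R[%classic : set tau_type) =
    (`[0, m%:R / N.+1%:R[%classic : set tau_type) `|`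
    `[m%:R / N.+1%:R, m.+1%:R / N.+1%:R[%classic.
  by rewrite -itv_bndbnd_setU// bnd_simp divr_ge0.
rewrite E ge0_integral_setU//; last 3 first.
- exact: measurable_funTS.
- by move=> x _; rewrite lee_fin.
- rewrite disj_set2E; apply/eqP/seteqP; split => // x [/=].
  by rewrite !in_itv/= => /andP[_ xm] /andP[mx _]; move: xm; rewrite ltNge mx.
rewrite IH big_ord_recr/= mulrDl EFinD; congr (_ + _)%E.
rewrite (eq_integral (cst (a m)%:E)); last first.
  move=> x; rewrite inE/= in_itv/= => /andP[mx xm] /=.
  by rewrite (grid_index_itv mx xm).
rewrite integral_cst//= lebesgue_measure_itv/= lte_fin ltr_pM2r ?invr_gt0// ltr_nat ltnSn.
by rewrite -EFinD -EFinM -mulrBl -natr1 addrAC subrr add0r div1r.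
Qed.

End grid_step.

Lemma tonelli_set d1 d2 (T1 : measurableType d1) (T2 : measurableType d2)
    (R : realType) (m1 : {sigma_finite_measure set T1 -> \bar R})
    (m2 : {sigma_finite_measure set T2 -> \bar R}) (D : set T1)
    (f : T1 * T2 -> \bar R) : measurable D ->
  measurable_fun setT f -> (forall z, 0 <= f z)%E ->
  measurable_fun setT (fun y => \int[m1]_(x in D) f (x, y))%E /\
  (\int[m1]_(x in D) \int[m2]_y f (x, y) = \int[m2]_y \int[m1]_(x in D) f (x, y))%E.
Proof.
move=> mD mf f0.
pose g := f \_ (D `*` setT).
have mg : measurable_fun setT g.
  by apply/(measurable_restrictT _ _).1; [exact: measurableX|exact: measurable_funTS].
have g0 z : (0 <= g z)%E by apply: erestrict_ge0 => z' _; exact: f0.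
have gE x y : g (x, y) = ((fun x => f (x, y)) \_ D) x.
  rewrite /g !patchE; congr (if _ then _ else _).
  by apply/idP/idP; rewrite !inE => // -[].
have E2 : (fun y => \int[m1]_(x in D) f (x, y))%E = (fun y => \int[m1]_x g (x, y))%E.
  by apply/funext => y; rewrite integral_mkcond; apply: eq_integral => x _; rewrite gE.
split; first by rewrite E2; exact: (measurable_fun_fubini_tonelli_G g).
have -> : (\int[m2]_y \int[m1]_(x in D) f (x, y) = \int[m2]_y \int[m1]_x g (x, y))%E.
  by apply: eq_integral => y _; exact: (congr1 (@^~ y) E2).
rewrite -(fubini_tonelli g)// integral_mkcond; apply: eq_integral => x _.
rewrite patchE; case: ifPn => xD.
  by apply: eq_integral => y _; rewrite gE patchE xD.
rewrite -[LHS](integral0 m2 setT); apply: eq_integral => y _.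
by rewrite gE patchE (negbTE xD).
Qed.

Lemma le_Lnorm d (T : measurableType d) (R : realType)
    (mu : {measure set T -> \bar R}) (p : R) (f g : T -> \bar R) : 0 < p ->
  measurable_fun setT f -> measurable_fun setT g ->
  (forall w, 0 <= f w <= g w)%E -> ('N[mu]_p%:E[f] <= 'N[mu]_p%:E[g])%E.
Proof.
move=> p0 mf mg fg.
have f0 w : (0 <= f w)%E by have /andP[] := fg w.
have g0 w : (0 <= g w)%E by have /andP[_] := fg w; exact: le_trans.
rewrite unlock; apply: ge0_le_poweR.
- by rewrite invr_ge0 ltW.
- by apply: integral_ge0 => w _; exact: poweR_ge0.
apply: ge0_le_integral => //.
- by move=> w _; exact: poweR_ge0.
- apply: (measurableT_comp (measurable_poweR p)).
  exact: (measurableT_comp (@abse_measurable R setT)).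
- apply: (measurableT_comp (measurable_poweR p)).
  exact: (measurableT_comp (@abse_measurable R setT)).
move=> w _; rewrite !gee0_abs//; apply: ge0_le_poweR => //; first exact: ltW.
by have /andP[_] := fg w.
Qed.

Lemma Lnorm_scale d (T : measurableType d) (R : realType)
    (mu : {measure set T -> \bar R}) (p c : R) (f : T -> R) : 0 < p -> 0 <= c ->
  measurable_fun setT f -> (forall w, 0 <= f w) ->
  ('N[mu]_p%:E[(fun w => (c * f w)%:E)] = c%:E * 'N[mu]_p%:E[EFin \o f])%E.
Proof.
move=> p0 c0 mf f0; rewrite unlock.
under eq_integral do rewrite abse_EFin ger0_norm ?mulr_ge0// poweR_EFin powRM// EFinM.
rewrite ge0_integralZl_EFin ?powR_ge0//; last 2 first.
- by move=> w _; rewrite lee_fin powR_ge0.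
- by apply/measurable_EFinP; exact: (measurableT_comp (@measurable_powR R p) mf).
have cp0 : (0 <= (c `^ p)%:E)%E by rewrite lee_fin powR_ge0.
have I0 : (0 <= \int[mu]_w (f w `^ p)%:E)%E.
  by apply: integral_ge0 => w _; rewrite lee_fin powR_ge0.
have cK : ((c `^ p)%:E `^ p^-1 = c%:E)%E.
  by rewrite -poweR_EFin poweR_invK ?gt_eqF.
rewrite (poweRM _ cp0 I0) cK; congr (_ * (_ `^ _))%E.
by apply: eq_integral => w _ /=; rewrite ger0_norm.
Qed.

Section continuous_averages.
Context d (T : measurableType d) (R : realType).
Variable mu : {finite_measure set T -> \bar R}.
Local Notation tau_type := (measurableTypeR R).
Let leb : {sigma_finite_measure set tau_type -> \bar R} := lebesgue_measure.
(** Here b stands for |Uf| and phi for the orbit of |f| under P. Only b is jointly measurable, so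
    phi is never integrated in time: it enters through the grid values [u N k], whose step functions
    are jointly measurable. *)
Variables (b : tau_type * T -> R) (phi : R -> T -> R^o) (p B C : R).
Hypothesis p1 : 1 < p.
Let p0 : 0 < p. Proof. exact: lt_trans ltr01 p1. Qed.
Let pN0 : p != 0. Proof. by rewrite gt_eqF. Qed.
Hypothesis mb : measurable_fun setT b.
Hypothesis b0 : forall z, 0 <= b z.
Hypothesis Lphi : forall t, 0 <= t -> in_Lp mu 1%E (phi t).
Hypothesis bphi : {ae lebesgue_measure, forall tau : tau_type, 0 <= (tau : R) ->
  {ae mu, forall w, b (tau, w) <= (phi tau w : R)}}.
Hypothesis phiC : forall t, 0 <= t -> (\int[mu]_w `|phi t w : R|%:E <= C%:E)%E.
Hypothesis phi_cont : forall tau, 0 < tau ->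
  (\int[mu]_w `|(phi t w : R) - phi tau w|%:E)%E @[t --> tau] --> 0%E.

Let u N k w : R := `|phi (k%:R / N.+1%:R) w : R|.
Let avg N k w : R := (\sum_(j < k.+1) u N j w) / k.+1%:R.

Hypothesis grid_bound : forall N n,
  ('N[mu]_p%:E[(fun w => (running_max 0 (fun k => avg N k w) n)%:E)] <= B%:E)%E.

Let grid_ge0 N k : 0 <= k%:R / N.+1%:R :> R.
Proof. by rewrite divr_ge0. Qed.

Let mphi t : 0 <= t -> measurable_fun setT (phi t : T -> R).
Proof. by move=> t0; have [] := (in_L1P mu (phi t)).1 (Lphi t0). Qed.

Let mu_ N k : measurable_fun setT (u N k).
Proof. by apply: measurableT_comp => //; apply: mphi. Qed.

Let M N n w : R := running_max 0 (fun k => avg N k w) n.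

Let mM N n : measurable_fun setT (M N n).
Proof.
apply: (@measurable_running_max _ _ _ (fun k w => avg N k w)) => k.
rewrite /avg; apply: measurable_funM => //; apply: measurable_sum => j.
exact: mu_.
Qed.

Let M0 N n w : 0 <= M N n w.
Proof. exact: running_max_ge_init. Qed.

(** Only the positive part of the error matters, since b needs to be bounded from above; being
    nonnegative, it is open to Tonelli's theorem. *)
Let err N (z : tau_type * T) : \bar R :=
  (Num.max (b z - u N (grid_index N z.1) z.2) 0)%:E.

Let merr N : measurable_fun setT (err N).
Proof.
apply/measurable_EFinP; apply: measurable_maxr => //; apply: measurable_funB => //.
by apply: (measurable_grid_step N) => k; exact: mu_.
Qed.

Let err0 N z : (0 <= err N z)%E.
Proof. by rewrite lee_fin le_max lexx orbT. Qed.

Let itv0 t : set tau_type := `[0, t]%classic.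

Let mitv0 t : measurable (itv0 t).
Proof. exact: measurable_itv. Qed.

Let avg_cont t w : \bar R := (\int[leb]_(tau in itv0 t) (b (tau, w))%:E)%E.
Let err_int N t w : \bar R := (\int[leb]_(tau in itv0 t) err N (tau, w))%E.

Let mavg_cont t : measurable_fun setT (avg_cont t).
Proof.
have mb' : measurable_fun setT (EFin \o b) by exact/measurable_EFinP.
have b0' z : (0 <= (EFin \o b) z)%E by rewrite lee_fin.
by have [] := @tonelli_set _ _ _ _ _ leb mu (itv0 t) (EFin \o b) (mitv0 t) mb' b0'.
Qed.

Let merr_int N t : measurable_fun setT (err_int N t).
Proof.
by have [] := @tonelli_set _ _ _ _ _ leb mu (itv0 t) (err N) (mitv0 t) (@merr N) (@err0 N).
Qed.

Let avg_cont0 t w : (0 <= avg_cont t w)%E.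
Proof. by apply: integral_ge0 => tau _; rewrite lee_fin. Qed.

Let err_int0 N t w : (0 <= err_int N t w)%E.
Proof. by apply: integral_ge0 => tau _; exact: err0. Qed.

Let mstep N w : measurable_fun setT
  (fun tau : tau_type => (u N (grid_index N tau) w)%:E).
Proof.
apply/measurable_EFinP.
exact: (measurable_fun_pair1 w (measurable_grid_step N (mu_ N))).
Qed.

(** With k the grid index of t, the interval [0, t] is covered by k + 1 cells of total length at
    most t + 1/(N+1). The step function over them integrates to that length times a Cesàro mean,
    which occurs in [M N m] because k < m. *)
Let avg_cont_le N t m w : 0 < t -> (grid_index N t < m)%N ->
  (avg_cont t w <= ((t + N.+1%:R^-1) * M N m w)%:E + err_int N t w)%E.
Proof.
move=> t0 gm.
pose k := grid_index N t.
have /andP[kt tk] : k%:R <= N.+1%:R * t < k.+1%:R.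
  by apply: truncn_itv; rewrite mulr_ge0// ltW.
have step : (\int[leb]_(tau in itv0 t) (u N (grid_index N tau) w)%:E <=
    ((t + N.+1%:R^-1) * M N m w)%:E)%E.
  apply: (@le_trans _ _ (\int[leb]_(tau in (`[0%R, (k.+1%:R / N.+1%:R)%R[%classic : set tau_type))
     (u N (grid_index N tau) w)%:E)%E).
    apply: ge0_subset_integral => //.
    - apply: measurable_funTS; exact: mstep.
    - by move=> x _; rewrite lee_fin /u.
    - move=> x /=; rewrite /itv0/= !in_itv/= => /andP[x0 xt]; apply/andP; split => //.
      by rewrite (le_lt_trans xt)// ltr_pdivlMr// mulrC.
  rewrite (integral_grid_step N k.+1 (fun j => normr_ge0 (phi (j%:R / N.+1%:R) w : R))).
  rewrite lee_fin.
  have -> : (\sum_(j < k.+1) `|phi (j%:R / N.+1%:R) w : R|) / N.+1%:R =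
      k.+1%:R / N.+1%:R * avg N k w.
    by rewrite [RHS]mulrC mulrA /avg divfK// pnatr_eq0.
  apply: ler_pM.
  - by rewrite divr_ge0.
  - by rewrite /avg divr_ge0// sumr_ge0// => j _; rewrite /u.
  - rewrite -natr1 mulrDl div1r lerD2r ler_pdivrMr// mulrC//.
  - exact: (running_max_ge (0 : R) (fun k => avg N k w) gm).
apply: (le_trans _ (leeD2r _ step)).
have u0 (x : tau_type) : itv0 t x -> (0 <= (u N (grid_index N x) w)%:E)%E.
  by move=> _; rewrite lee_fin /u.
have e0 (x : tau_type) : itv0 t x -> (0 <= err N (x, w))%E by move=> _; exact: err0.
have mut : measurable_fun (itv0 t) (fun x => (u N (grid_index N x) w)%:E).
  by apply: measurable_funTS; exact: mstep.
have met : measurable_fun (itv0 t) (fun x => err N (x, w)).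
  by apply: measurable_funTS; exact: (measurable_fun_pair1 w (merr N)).
rewrite -(ge0_integralD leb (mitv0 t) u0 mut e0 met).
apply: ge0_le_integral.
- exact: mitv0.
- by move=> x _; rewrite lee_fin.
- by apply/measurable_funTS/measurable_EFinP; exact: (measurable_fun_pair1 w mb).
- exact: emeasurable_funD.
move=> x _; rewrite /err -EFinD lee_fin /=.
by rewrite -lerBlDl le_max lexx.
Qed.

Let psi N (tau : tau_type) : \bar R := (\int[mu]_w err N (tau, w))%E.

(** The first bound makes psi tend to 0 by strong continuity; the second is the constant that
    dominates psi in the limit. Both come from b <= phi tau: the positive part of b - u is below |u
    - phi tau| and below |phi tau|. *)
Let ae_tau : {ae lebesgue_measure, forall tau : tau_type, 0 <= (tau : R) ->
  forall N, (psi N tau <= \int[mu]_w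
      (`|(phi ((grid_index N tau)%:R / N.+1%:R) w : R) - phi tau w|)%:E)%E
  /\ (psi N tau <= C%:E)%E}.
Proof.
apply: filterS bphi => tau H tau0 N; have {H} bt := H tau0.
have merrt : measurable_fun setT (fun w => err N (tau, w)).
  exact: (measurable_fun_pair2 (tau : tau_type) (merr N)).
split.
  apply: ae_ge0_le_integral => //.
  - apply/measurable_EFinP/measurableT_comp => //; apply: measurable_funB; exact: mphi.
  apply: filterS bt => w bw _; rewrite lee_fin ge_max normr_ge0 andbT /u/=.
  have := ler_norm (phi ((grid_index N tau)%:R / N.+1%:R) w : R).
  have := ler_norm (- ((phi ((grid_index N tau)%:R / N.+1%:R) w : R) - phi tau w)).
  by rewrite normrN; lra.
apply: (le_trans _ (phiC tau0)).
apply: ae_ge0_le_integral => //.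
- by apply/measurable_EFinP/measurableT_comp => //; exact: mphi.
apply: filterS bt => w bw _; rewrite lee_fin ge_max normr_ge0 andbT /u/=.
have := normr_ge0 (phi ((grid_index N tau)%:R / N.+1%:R) w : R).
by have := ler_norm (phi tau w : R); lra.
Qed.

Let mpsi N : measurable_fun setT (psi N).
Proof. exact: (@measurable_fun_fubini_tonelli_F _ _ _ _ _ mu (err N) (merr N) (@err0 N)). Qed.

Let psi0 N tau : (0 <= psi N tau)%E.
Proof. by apply: integral_ge0 => w _; exact: err0. Qed.

Lemma grid_index_cvg (tau : R) : 0 <= tau ->
  ((grid_index N tau)%:R / N.+1%:R : R) @[N --> \oo] --> tau.
Proof.
move=> tau0; apply: (@squeeze_cvgr _ _ _ _ (fun N => tau - N.+1%:R^-1) (fun=> tau)).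
- apply: nearW => N.
  have /andP[H1 H2] : (grid_index N tau)%:R <= N.+1%:R * tau < (grid_index N tau).+1%:R.
    by apply: truncn_itv; rewrite mulr_ge0.
  apply/andP; split; last by rewrite ler_pdivrMr// mulrC.
  by rewrite lerBlDr -[X in _ + X]div1r -mulrDl natr1 ler_pdivlMr// ltW// mulrC.
- rewrite -[X in _ --> X]subr0; apply: cvgB; first exact: cvg_cst.
  exact: cvg_harmonic.
- exact: cvg_cst.
Qed.

Let psi_cvg (tau : R) : 0 < tau ->
  (forall N, (psi N tau <= \int[mu]_w
      (`|(phi ((grid_index N tau)%:R / N.+1%:R) w : R) - phi tau w|)%:E)%E) ->
  psi N tau @[N --> \oo] --> 0%E.
Proof.
move=> tau0 H.
apply: (@squeeze_cvge _ _ _ _ (cst 0%E) _ (fun N => \int[mu]_w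
      (`|(phi ((grid_index N tau)%:R / N.+1%:R) w : R) - phi tau w|)%:E)%E).
- by apply: nearW => N; apply/andP; split; [exact: psi0|exact: H].
- exact: cvg_cst.
- have := cvg_comp _ (fun t => \int[mu]_w `|(phi t w : R) - phi tau w|%:E)%E
    (grid_index_cvg (ltW tau0)) (phi_cont tau0).
  exact.
Qed.

Let err_int_cvg t : 0 <= t -> (\int[mu]_w err_int N t w)%E @[N --> \oo] --> 0%E.
Proof.
move=> t0.
have E N : (\int[mu]_w err_int N t w = \int[leb]_(tau in itv0 t) psi N tau)%E.
  by have [_ <-] := @tonelli_set _ _ _ _ _ leb mu (itv0 t) (err N) (mitv0 t) (@merr N) (@err0 N).
under eq_fun do rewrite E.
have leb_fin : (leb (itv0 t) < +oo)%E.
  by rewrite /leb/= lebesgue_measure_itv/=; case: ifP => //; rewrite -EFinD ltry.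
have := @dominated_convergence _ _ _ leb (itv0 t) (mitv0 t) psi (cst 0%E) (cst C%:E).
rewrite integral0; case => //.
- by move=> N; apply: measurable_funTS; exact: mpsi.
(* Continuity is available at positive times only, so tau = 0 is discarded as a null set. *)
- have Hne : {ae leb, forall tau : tau_type, (tau : R) != 0}.
    exists [set 0 : tau_type]; split; first exact: measurable_set1.
      by rewrite /leb/= lebesgue_measure_set1.
    by move=> x /= /negP; rewrite negbK => /eqP.
  apply: filterS2 ae_tau Hne => tau H tauN0; rewrite /itv0/= in_itv/= => /andP[tau0 _].
  apply: psi_cvg; first by rewrite lt0r tauN0.
  by move=> N; have [] := H tau0 N.
- apply/integrableP; split => //.
  rewrite (_ : \int[leb]_(x in itv0 t) _ = `|C|%:E * leb (itv0 t))%E.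
    by rewrite lte_mul_pinfty ?lee_fin.
  exact: (integral_cst leb (mitv0 t) `|C|%:E).
- apply: filterS ae_tau => tau H N; rewrite /itv0/= in_itv/= => /andP[tau0 _].
  by rewrite gee0_abs ?psi0//; have [] := H tau0 N.
Qed.

Section finite_times.
Variables (t : nat -> R) (n : nat).
Hypothesis t0 : forall i, 0 < t i.

Let A i w : \bar R := ((t i)^-1%:E * avg_cont (t i) w)%E.
Let G w : \bar R := running_max 0%E (A ^~ w) n.
Let Err N w : \bar R := (\sum_(i < n) (t i)^-1%:E * err_int N (t i) w)%E.
Let c : R := \sum_(i < n) (t i)^-1.

Let tV0 i : 0 <= (t i)^-1. Proof. by rewrite invr_ge0 ltW. Qed.

Let c0 : 0 <= c. Proof. by apply: sumr_ge0 => i _; exact: tV0. Qed.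

Let mA i : measurable_fun setT (A i).
Proof. by apply: measurable_funeM; exact: mavg_cont. Qed.

Let A0 i w : (0 <= A i w)%E.
Proof. by apply: mule_ge0; [rewrite lee_fin tV0|exact: avg_cont0]. Qed.

Let mG : measurable_fun setT G.
Proof. by apply: emeasurable_running_max => i; exact: mA. Qed.

Let G0 w : (0 <= G w)%E. Proof. exact: running_max_ge_init. Qed.

Let mErr N : measurable_fun setT (Err N).
Proof.
by apply: emeasurable_sum => i; apply: measurable_funeM; exact: merr_int.
Qed.

Let Err0 N w : (0 <= Err N w)%E.
Proof.
by apply: sume_ge0 => i _; apply: mule_ge0; [rewrite lee_fin tV0|exact: err_int0].
Qed.

Let Err_cvg : (\int[mu]_w Err N w)%E @[N --> \oo] --> 0%E.
Proof.
have E N : (\int[mu]_w Err N w =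
    \sum_(i < n) (t i)^-1%:E * \int[mu]_w err_int N (t i) w)%E.
  rewrite ge0_integral_sum//.
  - by apply: eq_bigr => i _; rewrite ge0_integralZl_EFin.
  - by move=> i; apply: measurable_funeM; exact: merr_int.
  - by move=> i w _; apply: mule_ge0; [rewrite lee_fin tV0|exact: err_int0].
have Z : (\sum_(i < n) (t i)^-1%:E * 0 = 0 :> \bar R)%E.
  by rewrite big1// => i _; rewrite mule0.
suff : (\sum_(i < n) (t i)^-1%:E * \int[mu]_w err_int N (t i) w)%E @[N --> \oo] -->
    (\sum_(i < n) (t i)^-1%:E * 0)%E.
  by rewrite Z; under eq_fun do rewrite -E.
apply: cvg_nnesum => [i _|i _].
  apply: nearW => N; apply: mule_ge0; first by rewrite lee_fin tV0.
  by apply: integral_ge0 => w _; exact: err_int0.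
by apply: cvgeZl => //; apply: err_int_cvg; rewrite ltW.
Qed.

(** Dividing t + 1/(N+1) by t gives 1 + 1/(t (N+1)), and [c] bounds all the 1/t at once. The number
    m exceeds every grid index involved; it depends on N, but [grid_bound] is uniform in the number
    of averages. *)
Let G_le N : exists m, forall w,
  (G w <= ((1 + c / N.+1%:R) * M N m w)%:E + Err N w)%E.
Proof.
pose m := (\sum_(i < n) (grid_index N (t i)).+1)%N.
exists m => w.
have cN : 0 <= (1 + c / N.+1%:R) * M N m w.
  by rewrite mulr_ge0 ?M0// addr_ge0// divr_ge0// c0.
apply: running_max_le; first by apply: adde_ge0; [rewrite lee_fin|exact: Err0].
move=> k kn; have gm : (grid_index N (t k) < m)%N.
  by rewrite /m (bigD1 (Ordinal kn))//= addSn ltnS leq_addr.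
have tVc : (t k)^-1 <= c.
  by rewrite /c (bigD1 (Ordinal kn))//= lerDl sumr_ge0.
have H := avg_cont_le w (t0 k) gm.
apply: (@le_trans _ _ ((t k)^-1%:E * (((t k + N.+1%:R^-1) * M N m w)%:E + err_int N (t k) w))%E).
  by apply: lee_wpmul2l; rewrite ?lee_fin.
rewrite ge0_muleDr ?lee_fin//; last first.
  by rewrite mulr_ge0// addr_ge0// ltW.
apply: leeD.
  rewrite -EFinM lee_fin mulrA ler_wpM2r// mulrDr mulVf ?gt_eqF//.
  by rewrite lerD2l ler_wpM2r.
rewrite /Err (bigD1 (Ordinal kn))//= leeDl//.
by apply: sume_ge0 => i _; apply: mule_ge0; [rewrite lee_fin tV0|exact: err_int0].
Qed.

Section truncation.
Variable K : R.
Hypothesis K0 : 0 <= K.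

Let trunc (x : \bar R) : R := fine (mine x K%:E).

Let truncE x : (0 <= x)%E -> (trunc x)%:E = mine x K%:E.
Proof.
move=> x0; rewrite /trunc fineK// ge0_fin_numE ?le_min ?x0 ?lee_fin//.
by rewrite (le_lt_trans _ (ltry K))// ge_min lexx orbT.
Qed.

Let trunc0 x : (0 <= x)%E -> 0 <= trunc x.
Proof. by move=> x0; rewrite -lee_fin truncE// le_min x0 lee_fin. Qed.

Let mtrunc (f : T -> \bar R) : measurable_fun setT f ->
  measurable_fun setT (fun w => trunc (f w)).
Proof.
move=> mf; apply: (measurableT_comp (@fine_measurable R setT measurableT)).
exact: measurable_mine.
Qed.

(** For 0 <= x <= K one has x^p <= K^(p-1) x, which turns L_1 smallness into L_p smallness. *)
Let trunc_Err_Lnorm N :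
  ('N[mu]_p%:E[(fun w => (trunc (Err N w))%:E)] <=
   ((K `^ (p - 1))%:E * \int[mu]_w Err N w) `^ p^-1)%E.
Proof.
rewrite unlock; apply: ge0_le_poweR; first by rewrite invr_ge0 ltW.
  by apply: integral_ge0 => w _; exact: poweR_ge0.
rewrite -ge0_integralZl_EFin ?powR_ge0//.
apply: ge0_le_integral => //.
- by move=> w _; exact: poweR_ge0.
- apply: (measurableT_comp (measurable_poweR p)).
  apply: (measurableT_comp (@abse_measurable R setT)).
  by apply/measurable_EFinP; exact: mtrunc.
- exact: measurable_funeM.
move=> w _; rewrite abse_EFin ger0_norm ?trunc0// poweR_EFin.
rewrite -(mulr_powRB1 (trunc0 (Err0 N w)) p0) mulrC EFinM.
apply: lee_pmul; rewrite ?lee_fin ?powR_ge0 ?trunc0//.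
- apply: ge0_ler_powR; rewrite ?nnegrE ?trunc0//; first by rewrite subr_ge0 ltW.
  by rewrite -lee_fin truncE// ge_min lexx orbT.
- by rewrite truncE// ge_min lexx.
Qed.

(** The truncation may be moved onto the error alone, because min(a + b, K) <= a + min(b, K) for a
    >= 0; Minkowski's inequality then separates the two terms. *)
Let truncG_le N : ('N[mu]_p%:E[(fun w => (trunc (G w))%:E)] <=
  ((1 + c / N.+1%:R) * B)%:E + ((K `^ (p - 1))%:E * \int[mu]_w Err N w) `^ p^-1)%E.
Proof.
have [m Gm] := G_le N.
have mE : measurable_fun setT (fun w => trunc (Err N w)) by exact: mtrunc.
have cN : 0 <= 1 + c / N.+1%:R by rewrite addr_ge0// divr_ge0.
have mcM : measurable_fun setT (fun w => (1 + c / N.+1%:R) * M N m w).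
  by apply: measurable_funM.
apply: (@le_trans _ _ ('N[mu]_p%:E[(fun w =>
    ((1 + c / N.+1%:R) * M N m w + trunc (Err N w))%:E)])%E).
  apply: le_Lnorm => //.
  - by apply/measurable_EFinP; exact: mtrunc.
  - by apply/measurable_EFinP; exact: measurable_funD.
  move=> w; rewrite lee_fin trunc0//= EFinD !truncE//.
  have M1 : (0 <= ((1 + c / N.+1%:R) * M N m w)%:E)%E by rewrite lee_fin mulr_ge0.
  have [EK|KE] := leP (Err N w) K%:E.
    by rewrite ge_min Gm.
  by rewrite ge_min leeDr// orbT.
apply: le_trans (minkowski_EFin mu mcM mE (ltW p1)) _.
apply: leeD; last exact: trunc_Err_Lnorm.
rewrite [leLHS](Lnorm_scale mu p0 cN (mM N m) (M0 N m)) EFinM.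
by apply: lee_wpmul2l; [rewrite lee_fin|exact: grid_bound].
Qed.

Lemma continuous_average_truncated_Lnorm :
  ('N[mu]_p%:E[(fun w => mine (G w) K%:E)] <= B%:E)%E.
Proof.
have -> : (fun w => mine (G w) K%:E) = (fun w => (trunc (G w))%:E).
  by apply/funext => w; rewrite truncE.
have B0 : 0 <= B.
  by rewrite -lee_fin; apply: le_trans (grid_bound 0 0); exact: Lnorm_ge0.
apply/lee_addgt0Pr => _/posnumP[eta].
pose Kp := K `^ (p - 1).
have Kp1 : 0 < Kp + 1 by rewrite ltr_wpDl ?powR_ge0.
(* Half of eta is spent on c B/(N+1), half on the error: [del] is chosen so that K^(p-1) del <=
   (eta/2)^p, with [Kp + 1] because [Kp] vanishes for K = 0. *)
pose del := (eta%:num / 2) `^ p / (Kp + 1).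
have del0 : 0 < del by rewrite divr_gt0// powR_gt0.
have H1 := cvge0_lt Err_cvg del0.
have H2 : \forall N \near \oo, c * B * N.+1%:R^-1 < eta%:num / 2.
  have : (c * B) * harmonic N @[N --> \oo] --> (0 : R).
    rewrite -(mulr0 (c * B)); apply: cvgM; first exact: cvg_cst.
    exact: cvg_harmonic.
  by move=> /cvgr_lt; apply; rewrite divr_gt0.
near \oo => N.
have N1 : (\int[mu]_w Err N w < del%:E)%E by near: N; exact: H1.
have N2 : c * B * N.+1%:R^-1 < eta%:num / 2 by near: N; exact: H2.
apply: le_trans (truncG_le N) _.
rewrite [eta%:num]splitr EFinD addeA; apply: leeD.
  by rewrite -EFinD lee_fin mulrDl mul1r lerD2l mulrAC ltW.
have e20 : 0 <= eta%:num / 2 by [].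
rewrite -[leRHS](@poweR_invK _ p)//; apply: ge0_le_poweR.
- by rewrite invr_ge0 ltW.
- apply: mule_ge0; first by rewrite lee_fin powR_ge0.
  by apply: integral_ge0 => w _; exact: Err0.
apply: (@le_trans _ _ (Kp%:E * del%:E)%E).
  by apply: lee_wpmul2l; [rewrite lee_fin powR_ge0|exact: ltW].
rewrite -EFinM poweR_EFin lee_fin /del mulrCA ler_piMr ?powR_ge0//.
by rewrite ler_pdivrMr// mul1r lerDl.
Unshelve. all: by end_near. Qed.

End truncation.

Lemma finite_continuous_average_Lnorm : ('N[mu]_p%:E[G] <= B%:E)%E.
Proof.
have -> : G = (fun w => ereal_sup (range (fun k => mine (G w) k%:R%:E))).
  by apply/funext => w; rewrite ereal_sup_mine_nat.
apply: Lnorm_ereal_sup_le => //.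
- by move=> k; exact: measurable_mine.
- by move=> k w; rewrite le_min G0/= lee_fin.
- move=> w i j ij; rewrite le_min ge_min lexx/=.
  by rewrite ge_min lee_fin ler_nat ij orbT.
- by move=> k; apply: continuous_average_truncated_Lnorm; exact: ler0n.
Qed.

End finite_times.

Lemma continuous_average_Lnorm (t : nat -> R) : (forall i, 0 < t i) ->
  measurable_fun setT (fun w => ereal_sup (range (fun i => (t i)^-1%:E * avg_cont (t i) w)))%E /\
  ('N[mu]_p%:E[(fun w => ereal_sup (range (fun i => (t i)^-1%:E * avg_cont (t i) w)))]
    <= B%:E)%E.
Proof.
move=> t0.
pose A i w : \bar R := ((t i)^-1%:E * avg_cont (t i) w)%E.
have A0 i w : (0 <= A i w)%E.
  by apply: mule_ge0; [rewrite lee_fin invr_ge0 ltW// t0|exact: avg_cont0].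
have mA i : measurable_fun setT (A i).
  by apply: measurable_funeM; exact: mavg_cont.
split; first exact: (measurable_fun_ereal_sup mA).
rewrite (_ : (fun w => _) = (fun w => ereal_sup (range (fun n => running_max 0%E (A ^~ w) n)))).
  apply: Lnorm_ereal_sup_le => //.
  - by move=> n; exact: emeasurable_running_max.
  - by move=> n w; exact: running_max_ge_init.
  - by move=> w; apply/nondecreasing_seqP => n /=; rewrite le_max lexx.
  - by move=> n; exact: finite_continuous_average_Lnorm.
apply/funext => w; apply/eqP; rewrite eq_le; apply/andP; split.
  apply: ge_ereal_sup => _ [i _ <-]; apply: le_ereal_sup_tmp.
  by exists (running_max 0%E (A ^~ w) i.+1); [exists i.+1|rewrite /= le_max lexx orbT].
apply: ge_ereal_sup => _ [n _ <-]; apply: running_max_le.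
  by apply: le_trans (A0 0%N w) _; apply: ereal_sup_ubound; exists 0%N.
by move=> k _; apply: ereal_sup_ubound; exists k.
Qed.

End continuous_averages.

(** * Maximal inequalities for the dominating semigroup and for ergodic averages *)

Section dominated_ergodic_semigroup.
Context d (T : measurableType d) (R : realType).
Variable mu : {finite_measure set T -> \bar R}.
Variable P : R -> (T -> R^o) -> (T -> R^o).
Hypothesis PS : strongly_continuous_semigroup mu P.
Hypothesis Pc : forall t, 0 <= t -> L1_Loo_contraction mu (P t).
Hypothesis Ppos : forall t h, 0 <= t -> in_Lp mu 1%E h -> (forall w, 0 <= (h w : R)) ->
  {ae mu, forall w, 0 <= (P t h w : R)}.
Variables (b : measurableTypeR R * T -> R) (h : T -> R^o) (p : R).
Hypothesis p1 : 1 < p.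
Hypothesis mb : measurable_fun setT b.
Hypothesis b0 : forall z, 0 <= b z.
Hypothesis Lh : in_Lp mu 1%E h.
Hypothesis h0 : forall w, 0 <= (h w : R).
Hypothesis hp : ('N[mu]_p%:E[(fun w => (h w : R)%:E)] < +oo)%E.
Hypothesis bP : {ae lebesgue_measure, forall tau : measurableTypeR R, 0 <= (tau : R) ->
  {ae mu, forall w, b (tau, w) <= (P tau h w : R)}}.

Let PL t : 0 <= t -> L1_operator mu (P t).
Proof. by move=> t0; have [/(_ t t0)] := PS. Qed.

Let LP t : 0 <= t -> in_Lp mu 1%E (P t h).
Proof. by move=> t0; have [+ _ _] := PL t0; exact. Qed.

Let LnP t : 0 <= t -> in_Lp mu 1%E (fun w => `|P t h w : R| : R^o).
Proof.
move=> /LP /in_L1P[mP iP]; apply/in_L1P; split.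
  exact: measurableT_comp.
by under eq_integral do rewrite normr_id.
Qed.

Let ae_abs t : 0 <= t -> {ae mu, forall w, `|P t h w : R| = P t h w}.
Proof.
by move=> t0; apply: filterS (Ppos t0 Lh h0) => w; exact: ger0_norm.
Qed.

Let grid_step_ae N k : {ae mu, forall w,
  (`|P (k.+1%:R / N.+1%:R) h w : R| : R^o) =
  P N.+1%:R^-1 (fun w => `|P (k%:R / N.+1%:R) h w : R| : R^o) w}.
Proof.
have kN0 j : 0 <= j%:R / N.+1%:R :> R by rewrite divr_ge0.
have N0 : 0 < N.+1%:R^-1 :> R by rewrite invr_gt0.
have [_ Pcongr _] := PL (ltW N0).
have H1 := Pcongr _ _ (LnP (kN0 k)) (LP (kN0 k)) (ae_abs (kN0 k)).
have H2 := ae_abs (kN0 k.+1).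
have H3 : {ae mu, forall w, P N.+1%:R^-1 (P (k%:R / N.+1%:R) h) w =
    P (k.+1%:R / N.+1%:R) h w}.
  have [_ P0 Padd _] := PS.
  (* The semigroup law is given for positive times only; at k = 0 the identity P_0 = id takes its
     place. *)
  case: k {H1 H2} => [|k].
    rewrite mul0r mul1r; apply: Pcongr => //; first exact: LP.
    exact: P0.
  have := Padd N.+1%:R^-1 (k.+1%:R / N.+1%:R) h N0 _ Lh.
  rewrite divr_gt0// => /(_ isT).
  have -> // : N.+1%:R^-1 + k.+1%:R / N.+1%:R = k.+2%:R / N.+1%:R :> R.
  by rewrite -[k.+2%:R]natr1 mulrDl div1r addrC.
near=> w.
have -> : P N.+1%:R^-1 (fun w => `|P (k%:R / N.+1%:R) h w : R| : R^o) w =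
    P N.+1%:R^-1 (P (k%:R / N.+1%:R) h) w by near: w; exact: H1.
have -> : P N.+1%:R^-1 (P (k%:R / N.+1%:R) h) w = P (k.+1%:R / N.+1%:R) h w.
  by near: w; exact: H3.
by near: w; exact: H2.
Unshelve. all: by end_near. Qed.

Lemma dominated_ergodic_semigroup (t : nat -> R) : (forall i, 0 < t i) ->
  let v w := ereal_sup (range (fun i => (t i)^-1%:E *
    \int[lebesgue_measure]_(tau in (`[0%R, t i]%classic : set (measurableTypeR R)))
      (b (tau, w))%:E))%E in
  measurable_fun setT v /\
  ('N[mu]_p%:E[v] <= (p / (p - 1))%:E * 'N[mu]_p%:E[(fun w => (h w : R)%:E)])%E.
Proof.
move=> t0 v.
have q0 : 0 < p / (p - 1) by rewrite divr_gt0 ?subr_gt0// (lt_trans ltr01).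
have hfin : 'N[mu]_p%:E[(fun w => (h w : R)%:E)]%E \is a fin_num.
  by rewrite ge0_fin_numE; [exact: hp|exact: Lnorm_ge0].
have [mh ih] := (in_L1P mu h).1 Lh.
have ifin : (\int[mu]_w `|h w : R|%:E)%E \is a fin_num.
  by rewrite ge0_fin_numE//; apply: integral_ge0 => w _; rewrite lee_fin.
rewrite -(fineK hfin) -EFinM.
apply: (@continuous_average_Lnorm _ _ _ mu b (fun t => P t h) p _
  (fine (\int[mu]_w `|h w : R|%:E)%E)) => //.
- by move=> s s0; rewrite fineK//; apply: L1_contraction_integral Lh; exact: Pc.
- move=> tau tau0; have [_ _ _ /(_ h tau Lh tau0)] := PS.
  rewrite /Lpnorm; under eq_fun do rewrite Lnorm1.
  by under eq_fun do under eq_integral do rewrite abse_EFin normr_id.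
- move=> N n; rewrite EFinM fineK//.
  have N0 : 0 < N.+1%:R^-1 :> R by rewrite invr_gt0.
  pose u k w : R^o := `|P (k%:R / N.+1%:R) h w : R|.
  have kN0 j : 0 <= j%:R / N.+1%:R :> R by rewrite divr_ge0.
  have := @dominated_ergodic _ _ _ mu (P N.+1%:R^-1) (PL (ltW N0)) (Pc (ltW N0))
    (fun g => Ppos (ltW N0)) u (fun k => LnP (kN0 k)) (fun k w => normr_ge0 _)
    (grid_step_ae N) n p p1.
  move/le_trans; apply; rewrite le_eqVlt; apply/orP; left; apply/eqP; congr (_ * _)%E.
  apply: ae_eq_Lnorm.
  + apply/measurable_EFinP; have [+ _] := (in_L1P mu (u 0)).1 (LnP (kN0 0)).
    exact.
  + exact/measurable_EFinP.
  + have [_ P0 _ _] := PS.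
    have H := P0 h Lh.
    apply: filterS H => w; rewrite /u mul0r => ->.
    by rewrite ger0_norm.
Qed.

End dominated_ergodic_semigroup.

Section positivity.
Context d (T : measurableType d) (R : realType) (X : normedModType R).
Variable mu : {finite_measure set T -> \bar R}.

Lemma in_L1_scale (h : T -> R^o) (x : X) : in_Lp mu 1%E h ->
  in_Lp mu 1%E (fun w => (h w : R) *: x).
Proof.
move=> Lh; have [mh [s [ss sh]]] : measurable_fun setT (h : T -> R) /\
    strongly_measurable measurable h.
  by split; [have [] := (in_L1P mu h).1 Lh|case: Lh].
split.
  exists (fun n w => (s n w : R) *: x); split.
    move=> n; have [fs ms] := ss n; split.
      exact: (finite_range_comp fs (fun r : R^o => (r : R) *: x)).
    move=> y.
    exact: (measurable_finite_range_preimage fs ms ((fun r : R^o => (r : R) *: x) @^-1` [set y])).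
  by move=> w; apply: cvgZr_tmp; exact: sh.
have [_ ih] := (in_L1P mu h).1 Lh.
rewrite /Lpnorm Lnorm1.
under eq_integral do rewrite abse_EFin normr_id normrZ mulrC EFinM.
rewrite ge0_integralZl_EFin//; last first.
  by apply/measurable_EFinP; exact: measurableT_comp.
by rewrite lte_mul_pinfty// lee_fin.
Qed.

(** With e = x/|x| a unit vector, h is the norm of the X-valued function h e, so P_t h dominates
    |U_t (h e)|, which is nonnegative. *)
Lemma positively_dominated_ge0 (U : R -> (T -> X) -> (T -> X))
    (P : R -> (T -> R^o) -> (T -> R^o)) (x : X) : x != 0 ->
  positively_dominated mu U (P : R -> (T -> R) -> (T -> R)) ->
  forall t h, 0 <= t -> in_Lp mu 1%E h -> (forall w, 0 <= (h w : R)) ->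
  {ae mu, forall w, 0 <= (P t h w : R)}.
Proof.
move=> x0 UP t h t0 Lh h0.
have := UP _ _ (in_L1_scale (`|x|^-1 *: x) Lh) t0.
rewrite (_ : (fun w => `|(h w : R) *: (`|x|^-1 *: x)|) = h).
  by apply: filterS => w; apply: le_trans.
apply/funext => w; rewrite !normrZ normfV normr_id mulVf ?normr_eq0// mulr1.
exact: ger0_norm.
Qed.

End positivity.

Section ergodic_average_bound.
Context d (T : measurableType d) (R : realType) (X : completeNormedModType R).
Variable mu : {finite_measure set T -> \bar R}.

Lemma norm_ergodic_average_le (Uf : measurableTypeR R * T -> X) (t : R) (w : T) :
  0 < t -> strongly_measurable measurable Uf ->
  (`|ergodic_average Uf t w|%:E <= t^-1%:E *
    \int[lebesgue_measure]_(tau in (`[0%R, t]%classic : set (measurableTypeR R)))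
      `|Uf (tau, w)|%:E)%E.
Proof.
move=> t0 mU; rewrite /ergodic_average normrZ gtr0_norm ?invr_gt0// EFinM.
apply: lee_wpmul2l; first by rewrite lee_fin invr_ge0 ltW.
have mI : measurable (`[0%R, t]%classic : set (measurableTypeR R)).
  exact: measurable_itv.
apply: norm_bochner_le => //.
  by rewrite /= lebesgue_measure_itv/=; case: ifP => //; rewrite -EFinD ltry.
apply/measurable_funTS/measurable_EFinP.
exact: (measurable_fun_pair1 w (measurable_norm mU)).
Qed.

Lemma in_Lp_in_L1 (f : T -> X) (p : R) : 1 < p -> in_Lp mu p%:E f -> in_Lp mu 1%E f.
Proof.
move=> p1 [mf fp]; split => //.
have p0 : 0 < p := lt_trans ltr01 p1.
have mfn : measurable_fun setT (fun w => `|f w|) := measurable_norm mf.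
have mfp : measurable_fun setT (fun w => `|f w| `^ p).
  exact: (measurableT_comp (@measurable_powR R p) mfn).
rewrite /Lpnorm Lnorm1; under eq_integral do rewrite abse_EFin normr_id.
apply: (@le_lt_trans _ _ (\int[mu]_w (1%:E + (`|f w| `^ p)%:E))%E).
  apply: ge0_le_integral => //.
  - exact/measurable_EFinP.
  - by apply: emeasurable_funD => //; exact/measurable_EFinP.
  move=> w _; rewrite -EFinD lee_fin.
  have [f1|f1] := leP `|f w| 1; first by rewrite ler_wpDr// powR_ge0.
  by rewrite ler_wpDl// le1r_powR// ltW.
rewrite ge0_integralD//; last exact/measurable_EFinP.
apply: lte_add_pinfty.
  by rewrite integral_cst// mul1e -ge0_fin_numE// fin_num_measure.
have := poweR_lty p fp; rewrite /Lpnorm poweR_Lnorm ?gt_eqF//.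
by under eq_integral do rewrite abse_EFin normr_id poweR_EFin.
Qed.

Variables (U : R -> (T -> X) -> (T -> X)) (P : R -> (T -> R^o) -> (T -> R^o)).
Variables (p : R) (f : T -> X) (Uf : measurableTypeR R * T -> X).
Hypothesis PS : strongly_continuous_semigroup mu P.
Hypothesis Pc : forall t, 0 <= t -> L1_Loo_contraction mu (P t).
Hypothesis UP : positively_dominated mu U (P : R -> (T -> R) -> (T -> R)).
Hypothesis p1 : 1 < p.
Hypothesis fp : in_Lp mu p%:E f.
Hypothesis jU : joint_version mu U f Uf.

(** The function v is built from the paths of [Uf], not from classes, so it dominates the averages
    at every point, as [doob_weak] requires. *)
Lemma ergodic_average_maximal (t : nat -> R) : (forall i, 0 < t i) ->
  exists v : T -> \bar R, [/\ measurable_fun setT v, forall w, (0 <= v w)%E,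
    forall i w, (`|ergodic_average Uf (t i) w|%:E <= v w)%E &
    ('N[mu]_p%:E[v] <= (p / (p - 1))%:E * Lpnorm mu p%:E f)%E].
Proof.
move=> t0; have [mU aU] := jU.
pose I i w : \bar R := ((t i)^-1%:E *
  \int[lebesgue_measure]_(tau in (`[0%R, t i]%classic : set (measurableTypeR R)))
    `|Uf (tau, w)|%:E)%E.
have I0 i w : (0 <= I i w)%E.
  apply: mule_ge0; first by rewrite lee_fin invr_ge0 ltW.
  by apply: integral_ge0 => tau _; rewrite lee_fin.
exists (fun w => ereal_sup (range (I ^~ w))).
have vI i w : (I i w <= ereal_sup (range (I ^~ w)))%E.
  by apply: ereal_sup_ubound; exists i.
suff [mv Nv] : measurable_fun setT (fun w => ereal_sup (range (I ^~ w))) /\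
    ('N[mu]_p%:E[(fun w => ereal_sup (range (I ^~ w)))] <=
      (p / (p - 1))%:E * Lpnorm mu p%:E f)%E.
  split => //.
  - by move=> w; apply: le_trans (vI 0%N w).
  - by move=> i w; apply: le_trans (vI i w); exact: norm_ergodic_average_le.
(* If X = 0 there is no unit vector from which to derive positivity of P, but then every average
   vanishes. *)
have [[x x0]|X0] := pselect (exists x : X, x != 0).
  have Ppos := positively_dominated_ge0 x0 UP.
  have Lf : in_Lp mu 1%E (fun w => `|f w| : R^o).
    have [mf] := in_Lp_in_L1 p1 fp.
    rewrite /Lpnorm Lnorm1; under eq_integral do rewrite abse_EFin normr_id.
    move=> fi; apply/in_L1P; split; first exact: measurable_norm.
    by under eq_integral do rewrite normr_id.
  apply: (@dominated_ergodic_semigroup _ _ _ mu P PS Pc Ppos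
    (fun z => `|Uf z|) (fun w => `|f w|) p p1) => //.
  - exact: measurable_norm.
  - by case: fp.
  - apply: filterS aU => tau H tau0.
    have H2 := UP (in_Lp_in_L1 p1 fp) tau0.
    by apply: filterS2 (H tau0) H2 => w ->.
have zX (y : X) : y = 0.
  by apply/eqP/negPn/negP => y0; apply: X0; exists y.
have -> : (fun w => ereal_sup (range (I ^~ w))) = cst 0%E.
  apply/funext => w; apply/eqP; rewrite eq_le; apply/andP; split; last first.
    exact: le_trans (vI 0%N w).
  apply: ge_ereal_sup => _ [i _ <-]; rewrite /I.
  rewrite (eq_integral (cst 0%E)); last by move=> tau _; rewrite (zX (Uf _)) normr0.
  by rewrite integral0 mule0.
split; first exact: measurable_cst.
rewrite Lnorm0; last by rewrite eqe gt_eqF// (lt_trans ltr01).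
apply: mule_ge0; last exact: Lnorm_ge0.
by rewrite lee_fin divr_ge0// ?subr_ge0 ltW// (lt_trans ltr01).
Qed.

End ergodic_average_bound.

(** * The essential supremum *)

Section essential_supremum.
Context d (T : measurableType d) (R : realType) (mu : {measure set T -> \bar R}).
Local Open Scope ereal_scope.

Lemma integrable_le_ae_eq (f g : T -> \bar R) :
  measurable_fun setT f -> measurable_fun setT g ->
  (forall w, 0 <= f w <= g w) -> \int[mu]_w g w < +oo ->
  \int[mu]_w g w <= \int[mu]_w f w -> {ae mu, forall w, f w = g w}.
Proof.
move=> mf mg fg goo gf.
have f0 w : 0 <= f w by case/andP: (fg w).
have fleg w : f w <= g w by case/andP: (fg w).
have g0 w : 0 <= g w by apply: le_trans (fleg w).
have iG : mu.-integrable setT g.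
  by apply/integrableP; split => //; under eq_integral do rewrite gee0_abs//.
have iF : mu.-integrable setT f.
  by apply: (le_integrable measurableT mf _ iG) => w _; rewrite !gee0_abs.
have gfin := integrable_ae measurableT iG.
have mgf : measurable_fun setT (g \- f) by exact: emeasurable_funB.
have Z : \int[mu]_w `|(g \- f) w| = 0.
  transitivity (\int[mu]_w (g \- f) w).
    apply: ae_eq_integral => //; first exact: measurableT_comp.
    apply: filterS gfin => w /(_ I) gw _ /=.
    by rewrite gee0_abs// sube_ge0// gw orbT.
  rewrite integralB//; apply/eqP; rewrite sube_eq.
  - rewrite add0e eq_le gf/=; exact: ge0_le_integral.
  - exact: integrable_fin_num.
  - by apply: fin_num_adde_defl; exact: integrable_fin_num.
have /(ae_eq_integral_abs mu measurableT mgf) := Z.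
apply: filterS2 gfin => w /(_ I) gw /(_ I) /= gf0.
have fw : f w \is a fin_num.
  by rewrite ge0_fin_numE//; apply: le_lt_trans (fleg w) _; rewrite -ge0_fin_numE.
move: gf0; rewrite -(fineK gw) -(fineK fw) -EFinB => -[] /eqP.
by rewrite subr_eq0 => /eqP ->.
Qed.

(* A countable subfamily whose supremum has maximal integral. *)
Lemma exists_ae_sup (J : Type) (I : set J) (h : J -> T -> \bar R) (j0 : J) (C : R) :
  I j0 -> (forall j, I j -> measurable_fun setT (h j)) ->
  (forall j w, 0 <= h j w) ->
  (forall i : nat -> J, (forall n, I (i n)) ->
    \int[mu]_w ereal_sup (range (fun n => h (i n) w)) <= C%:E) ->
  exists2 i : nat -> J, (forall n, I (i n)) &
    is_ae_sup mu I h (fun w => ereal_sup (range (fun n => h (i n) w))).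
Proof.
move=> Ij0 mh h0 hC.
pose S (i : nat -> J) w := ereal_sup (range (fun n => h (i n) w)).
have mS i : (forall n, I (i n)) -> measurable_fun setT (S i).
  by move=> Ii; apply: (measurable_fun_ereal_sup (u := fun n => h (i n))) => n; exact: mh.
have S0 i w : 0 <= S i w.
  by apply: le_trans (h0 (i 0%N) w) _; apply: ereal_sup_ubound; exists 0%N.
have Sge i n w : h (i n) w <= S i w by apply: ereal_sup_ubound; exists n.
pose V := [set \int[mu]_w S i w | i in [set i | forall n, I (i n)]].
have Vne : V (\int[mu]_w S (fun=> j0) w) by exists (fun=> j0).
have c0 : 0 <= ereal_sup V.
  apply: le_trans (ereal_sup_ubound Vne).
  by apply: integral_ge0 => w _; exact: S0.
have cC : ereal_sup V <= C%:E by apply: ge_ereal_sup => _ [i Ii <-]; exact: hC.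
have cfin : ereal_sup V \is a fin_num.
  by rewrite ge0_fin_numE// (le_lt_trans cC)// ltry.
have /choice[ik ikP] : forall k : nat, exists i : nat -> J, (forall n, I (i n)) /\
    ereal_sup V - k.+1%:R^-1%:E < \int[mu]_w S i w.
  move=> k; have k0 : (0 < k.+1%:R^-1 :> R)%R by rewrite invr_gt0.
  by have [_ [i Ii <-] H] := ub_ereal_sup_adherent k0 cfin; exists i.
(* A pairing of the naturals merges the near-optimal sequences [ik k] into one sequence, whose
   supremum attains the maximal integral. *)
pose dec n : nat * nat := odflt (0%N, 0%N) (unpickle n).
pose i n := ik (dec n).1 (dec n).2.
have Ii n : I (i n) by have [+ _] := ikP (dec n).1; exact.
have Si k w : S (ik k) w <= S i w.
  apply: ge_ereal_sup => _ [n _ <-].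
  have -> : h (ik k n) w = h (i (pickle (k, n))) w by rewrite /i /dec pickleK.
  exact: Sge.
exists i => //; split.
- exact: mS.
(* Putting j in front of the sequence raises its supremum but cannot raise an integral that is
   already maximal and finite, so both suprema agree almost everywhere. *)
- move=> j Ij; pose i' n := if n is n'.+1 then i n' else j.
  have Ii' n : I (i' n) by case: n.
  have SS' w : S i w <= S i' w.
    by apply: ge_ereal_sup => _ [n _ <-]; exact: (Sge i' n.+1).
  have S'V : \int[mu]_w S i' w <= ereal_sup V by apply: ereal_sup_ubound; exists i'.
  have VS : ereal_sup V <= \int[mu]_w S i w.
    apply/lee_addgt0Pr => e e0.
    have [k ke] : exists k : nat, (k.+1%:R^-1 < e)%R.
      near \oo => k; exists k; near: k; exact: near_infty_natSinv_lt (PosNum e0).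
    have [_ /ltW] := ikP k; rewrite leeBlDr// => H; apply: le_trans H _.
    apply: leeD; last by rewrite lee_fin ltW.
    apply: ge0_le_integral => //; [by apply: mS; case: (ikP k)|exact: mS].
  have H : {ae mu, forall w, S i w = S i' w}.
    apply: integrable_le_ae_eq => //; [exact: mS|exact: mS| | |].
    - by move=> w; rewrite S0 SS'.
    - by apply: le_lt_trans S'V _; rewrite -ge0_fin_numE.
    - exact: le_trans S'V VS.
  by apply: filterS H => w Hw; rewrite -/(S i w) Hw; exact: (Sge i' 0%N).
- move=> S' mS' hS'; have H : {ae mu, forall w n, h (i n) w <= S' w}.
    by apply: ae_foralln => n; exact: hS'.
  by apply: filterS H => w H; apply: ge_ereal_sup => _ [n _ <-].
Unshelve. all: by end_near. Qed.

End essential_supremum.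

(** * Hölder's inequality on a finite measure space and the theorem *)

Section Lp_finite_measure.
Context d (T : measurableType d) (R : realType).
Variable mu : {finite_measure set T -> \bar R}.
Local Open Scope ereal_scope.
Variables (p : R) (v : T -> \bar R).
Hypothesis p1 : (1 < p)%R.
Hypothesis mv : measurable_fun setT v.
Hypothesis v0 : forall w, 0 <= v w.

(** Hölder's inequality against the constant 1. Through the power of mu(Omega) the total mass enters
    the weak-type clause; the same bound supplies the finite integrals that the essential supremum
    needs. *)
Lemma integral_le_Lnorm : 'N[mu]_p%:E[v] < +oo ->
  \int[mu]_w v w <= 'N[mu]_p%:E[v] * mu setT `^ (1 - p^-1).
Proof.
move=> voo; have p0 : (0 < p)%R := lt_trans ltr01 p1.
have vfin := Lnorm_lty_ae_fin p0 mv v0 voo.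
have mf : measurable_fun setT (fun w => fine (v w)).
  exact: (measurableT_comp (@fine_measurable R setT measurableT)).
have qE : ((1 - p^-1)^-1^-1 = 1 - p^-1)%R by rewrite invrK.
have q0 : (0 < (1 - p^-1)^-1)%R by rewrite invr_gt0 subr_gt0 invf_lt1.
have pq : (p^-1 + (1 - p^-1)^-1^-1 = 1)%R by rewrite qE addrC subrK.
have := @hoelder _ _ _ mu (fun w => fine (v w)) (cst 1%R) _ _ mf (measurable_cst _) p0 q0 pq.
rewrite Lnorm_cst1 qE.
rewrite -(ae_eq_Lnorm p mv _ vfin); last exact/measurable_EFinP.
apply: le_trans; rewrite Lnorm1 le_eqVlt; apply/orP; left; apply/eqP.
apply: ae_eq_integral => //.
- apply: (measurableT_comp (@abse_measurable R setT)).
  by apply/measurable_EFinP; exact: measurable_funM.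
- apply: filterS vfin => w vw _ /=.
  by rewrite mulr1 ger0_norm ?fine_ge0.
Qed.

End Lp_finite_measure.

(* The weak-type estimate is not invariant under scaling of mu and fails for
   large total mass: for X = R, T_t = P_t = id, f = 1, p = 2, eps = 1 and
   mu(Omega) = 16 it would read 16 <= 8. Hence the normalization mu(Omega) <= 1
   in that clause only. *)
Theorem theorem3p3 (R : realType) (X : completeNormedModType R)
    (d : measure_display) (Omega : measurableType d)
    (mu : {finite_measure set Omega -> \bar R})
    (T : R -> (Omega -> X) -> (Omega -> X))
    (P : R -> (Omega -> R) -> (Omega -> R))
    (p : R) (f : Omega -> X) (Tf : measurableTypeR R * Omega -> X)
    (F : R -> set (set Omega)) (Finf : set (set Omega))
    (E : R -> R -> Omega -> X) :
  separable_space X -> reflexive_space X ->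
  strongly_continuous_semigroup mu T ->
  (forall t, 0 <= t -> L1_Loo_contraction mu (T t)) ->
  strongly_continuous_semigroup mu (P : R -> (Omega -> R^o) -> (Omega -> R^o)) ->
  (forall t, 0 <= t ->
     L1_Loo_contraction mu (P t : (Omega -> R^o) -> (Omega -> R^o))) ->
  positively_dominated mu T P ->
  1 < p -> in_Lp mu p%:E f ->
  joint_version mu T f Tf ->
  mu.-integrable setT (fun w =>
    ereal_sup [set `|ergodic_average Tf t w|%:E | t in [set t | 0 < t]]) ->
  decreasing_family F Finf ->
  (forall t s, 0 < t -> 0 <= s ->
     is_condexp mu (F s) (ergodic_average Tf t) (E t s)) ->
  exists2 S : Omega -> \bar R,
    is_ae_sup mu [set ts : R * R | 0 < ts.1 /\ 0 <= ts.2]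
      (fun ts w => `|E ts.1 ts.2 w|%:E) S &
    ('N[mu]_p%:E [S] <= ((p / (p - 1)) ^+ 2)%:E * Lpnorm mu p%:E f)%E /\
    ((mu setT <= 1)%E -> forall eps : R, 0 < eps ->
       (mu [set w | eps%:E <= S w]
        <= (p / (p - 1))%:E * (Lpnorm mu p%:E f * (eps^-1)%:E))%E).
Proof.
move=> _ _ _ _ PS Pc TP p1 fp jT _ dF cE.
have p0 : 0 < p := lt_trans ltr01 p1.
have q0 : 0 < p / (p - 1) by rewrite divr_gt0 ?subr_gt0.
have [mf fpoo] := fp.
have Nf0 : (0 <= Lpnorm mu p%:E f)%E by exact: Lnorm_ge0.
have Nffin : Lpnorm mu p%:E f \is a fin_num by rewrite ge0_fin_numE.
pose I := [set ts : R * R | 0 < ts.1 /\ 0 <= ts.2].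
pose h (ts : R * R) w := `|E ts.1 ts.2 w|%:E.
have mh ts : I ts -> measurable_fun setT (h ts).
  move=> [t0 s0]; have [_ [mE _] _] := cE _ _ t0 s0.
  by apply/measurable_EFinP; exact: measurable_norm.
have h0 ts w : (0 <= h ts w)%E by rewrite lee_fin.
pose S (i : nat -> R * R) w := ereal_sup (range (fun n => h (i n) w)).
have S0 i w : (0 <= S i w)%E.
  by apply: le_trans (h0 (i 0%N) w) _; apply: ereal_sup_ubound; exists 0%N.
have mS i : (forall n, I (i n)) -> measurable_fun setT (S i).
  by move=> Ii; apply: (measurable_fun_ereal_sup (u := fun n => h (i n))) => n; exact: mh.
(* Both clauses rest on this v: (1) applies [maximal_Lnorm] to the pair (S, v), whereas (2) uses
   only the integral of v. *)
have key i : (forall n, I (i n)) -> exists v : Omega -> \bar R,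
    [/\ measurable_fun setT v, forall w, (0 <= v w)%E,
    ('N[mu]_p%:E[v] <= (p / (p - 1))%:E * Lpnorm mu p%:E f)%E &
    forall l, 0 < l -> (l%:E * mu [set w | (l%:E < S i w)%E] <=
      \int[mu]_(w in [set w | (l%:E < S i w)%E]) v w)%E].
  move=> Ii.
  have [v [mv v0 Av Nv]] := ergodic_average_maximal PS Pc TP p1 fp jT
    (fun n => (Ii n).1 : 0 < (i n).1).
  exists v; split => // l l0.
  apply: (doob_weak dF (u := ergodic_average Tf)
    (E := fun ts => E ts.1 ts.2) mv v0 l0) => n.
  by have [t0 s0] := Ii n; split => //; exact: cE.
have strong i : (forall n, I (i n)) ->
    ('N[mu]_p%:E[S i] <= ((p / (p - 1)) ^+ 2)%:E * Lpnorm mu p%:E f)%E.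
  move=> Ii; have [v [mv v0 Nv wk]] := key _ Ii.
  apply: le_trans (maximal_Lnorm p1 (mS _ Ii) mv (S0 i) v0 wk) _.
  rewrite expr2 (EFinM (p / (p - 1))) -muleA; apply: lee_wpmul2l => //.
  by rewrite lee_fin ltW.
have fin2 : (((p / (p - 1)) ^+ 2)%:E * Lpnorm mu p%:E f)%E \is a fin_num.
  exact: fin_numM.
(* One bound for the integrals of the suprema of all countable subfamilies, as [exists_ae_sup]
   requires. *)
pose C : \bar R := ((((p / (p - 1)) ^+ 2)%:E * Lpnorm mu p%:E f) *
  mu setT `^ (1 - p^-1))%E.
have Cfin : C \is a fin_num.
  by apply: fin_numM => //; apply: fin_num_poweR; exact: fin_num_measure.
have I1 : I (1, 0) by split => /=.
have hC (i : nat -> R * R) : (forall n, I (i n)) ->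
    (\int[mu]_w ereal_sup (range (fun n => h (i n) w)) <= (fine C)%:E)%E.
  move=> Ii; rewrite fineK//.
  have NS := strong _ Ii.
  apply: le_trans (integral_le_Lnorm p1 (mS _ Ii) (S0 i) _) _.
    by apply: le_lt_trans NS _; rewrite -ge0_fin_numE// mule_ge0// lee_fin exprn_ge0// ltW.
  by apply: lee_wpmul2r => //; exact: poweR_ge0.
have [i Ii supS] := exists_ae_sup I1 mh h0 hC.
exists (S i) => //; split; first exact: strong.
move=> mu1 eps eps0.
have [v [mv v0 Nv wk]] := key _ Ii.
have mSi := mS _ Ii.
have mA : measurable [set w | (eps%:E <= S i w)%E].
  by rewrite -[X in measurable X]setTI; exact: emeasurable_fun_c_infty.
have iv : (\int[mu]_w v w <= (p / (p - 1))%:E * Lpnorm mu p%:E f)%E.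
  apply: le_trans (integral_le_Lnorm p1 mv v0 _) _.
    by apply: le_lt_trans Nv _; rewrite -ge0_fin_numE ?fin_numM// mule_ge0// lee_fin ltW.
  rewrite -[leRHS]mule1; apply: lee_pmul => //; first exact: Lnorm_ge0.
    exact: poweR_ge0.
  rewrite -(poweR1r (1 - p^-1)); apply: ge0_le_poweR => //.
  by rewrite subr_ge0 invf_le1// ltW.
(* Doob's inequality concerns {S > l}, the claim {S >= eps}: the latter lies in the former for l <
   eps, and l = r eps with r -> 1 recovers the level eps. *)
have wk' l : 0 < l -> l < eps -> (l%:E * mu [set w | (eps%:E <= S i w)%E] <=
    (p / (p - 1))%:E * Lpnorm mu p%:E f)%E.
  move=> l0 le; have ml : measurable [set w | (l%:E < S i w)%E].
    by rewrite -[X in measurable X]setTI; exact: emeasurable_fun_o_infty.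
  apply: le_trans iv; apply: le_trans (le_trans (wk l l0) _).
    apply: lee_wpmul2l; first by rewrite lee_fin ltW.
    apply: le_measure; rewrite ?inE// => w /=; apply: lt_le_trans.
    by rewrite lte_fin.
  by apply: ge0_subset_integral.
rewrite muleA lee_pdivlMr// muleC.
have m0 : (0 <= eps%:E * mu [set w | (eps%:E <= S i w)%E])%E.
  by apply: mule_ge0 => //; rewrite lee_fin ltW.
apply/lee_mul01Pr => // r /andP[r0 r1].
rewrite muleA -EFinM; apply: wk'; first exact: mulr_gt0.
by rewrite gtr_pMl.
Qed.
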